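(* Let $F$ be a probability distribution on $(0,\infty)$ with Laplace transform $\phi(y)=\int_0^\infty e^{-yx}F(dx)$, and for $u\in(0,1]$ let $F_u$ be the probability distribution $$F_u(dx)=\frac{e^{-x\phi^{-1}(u)}}{u}F(dx).$$ For each $n\ge1$ let $(X_n[1],\ldots,X_n[n])$ be the size-biased permutation of an i.i.d. sequence of length $n$ with distribution $F$, and for $u\in(0,1]$ let $F_{n,u}(\cdot)$ denote the empirical distribution of its last $\lfloor nu\rfloor$ values. Then for each $\delta\in(0,1)$, as $n\to\infty$, $$\sup_{u\in[\delta,1]}\ \sup_{\mathbf I}\ |F_{n,u}(\mathbf I)-F_u(\mathbf I)|\longrightarrow0\quad\text{almost surely},$$ where $\mathbf I$ ranges over all subintervals of $(0,\infty)$.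
   Context: Size-biased permutation: for positive numbers $x(1),\ldots,x(n)$ with sum $t$, it is the sequence $(x(\sigma_1),\ldots,x(\sigma_n))$ where $\sigma$ is the random permutation with $\mathbb P(\sigma_1=i)=x(i)/t$ and, for distinct indices $i_1,\ldots,i_k$, $\mathbb P(\sigma_k=i_k\mid\sigma_1=i_1,\ldots,\sigma_{k-1}=i_{k-1})=\dfrac{x(i_k)}{t-(x(i_1)+\cdots+x(i_{k-1}))}$. The size-biased permutation of a random sequence is defined by conditioning on the values of the sequence. All the sequences, for different $n$, are defined on a common probability space. $\phi^{-1}:(0,1]\to[0,\infty)$ is the inverse function of $\phi$ (so $\phi^{-1}(1)=0$). The empirical distribution of $m$ values is the probability measure giving mass $1/m$ to each; $F_{n,u}$ is considered for $n$ large enough that $\lfloor nu\rfloor\ge1$. *)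

(* Defs.v *)
From HB Require Import structures.
From mathcomp Require Export all_boot all_order all_algebra perm.
From mathcomp Require Export all_classical all_reals all_analysis.

Set Implicit Arguments.
Unset Strict Implicit.
Unset Printing Implicit Defensive.

Export Order.TTheory GRing.Theory Num.Theory.
Export numFieldNormedType.Exports.

Local Open Scope classical_set_scope.
Local Open Scope ring_scope.

Section laplace.
Context {R : realType}.
Implicit Type F : probability (measurableTypeR R) R.

Definition laplace F (y : R) : R :=
  \int[F]_(x in `]0, +oo[) expR (- (y * x)).

(* If F is carried by ]0, +oo[, then [laplace F] is a bijection from [0, +oo[
   onto ]0, 1]; outside ]0, 1] the value is arbitrary. *)
Definition laplace_inv F : R -> R :=
  'pinv_(fun=> 0) `[0, +oo[ (laplace F).

(* F_u; a probability distribution when F is carried by ]0, +oo[ and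
   0 < u <= 1. *)
Definition tilted F (u : R) (A : set R) : R :=
  \int[F]_(x in A) (expR (- (x * laplace_inv F u)) / u).

End laplace.

Section empirical.
Context {R : realType}.

Definition empirical (s : seq R) (A : set R) : R :=
  (\sum_(x <- s) \1_A x) / (size s)%:R.

Definition last_values n (m : nat) (x : 'I_n -> R) : seq R :=
  drop (n - m) [seq x i | i <- enum 'I_n].

End empirical.

Section random_sequences.
Context {R : realType} {d : measure_display} {Omega : measurableType d}.
Variables (P : probability Omega R) (n : nat).
Implicit Types X Y : 'I_n -> {RV P >-> R}.

Definition mutually_independent Y : Prop :=
  forall (J : {set 'I_n}) (A : 'I_n -> set R),
    (forall i, i \in J -> measurable (A i)) ->
    P (\bigcap_(i in [set` J]) (Y i @^-1` A i)) =
    (\prod_(i in J) P (Y i @^-1` A i))%E.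

Definition iid (F : probability (measurableTypeR R) R) Y : Prop :=
  mutually_independent Y /\
  forall i (A : set R), measurable A -> distribution P (Y i) A = F A.

(* Conditionally on the values of Y, the random permutation sigma satisfies
     P(sigma_k = i_k | sigma_1 = i_1, ..., sigma_(k-1) = i_(k-1))
       = Y(i_k) / (t - (Y(i_1) + ... + Y(i_(k-1)))),   t = Y(1) + ... + Y(n).
   The conditional probability given Y and the event that the first k-1 values
   are i_1, ..., i_(k-1) is expressed by its defining property, i.e., by
   integration over this event intersected with an arbitrary Y-measurable
   event [Y \in B]. Indices start at 0, and the distinct indices i_1, ..., i_k
   are the first values of a permutation s. *)
Definition size_biased_choice Y (sigma : Omega -> 'S_n) : Prop :=
  (forall s : 'S_n, measurable (sigma @^-1` [set s])) /\
  forall (k : 'I_n) (s : 'S_n) (B : set (n.-tuple R)), measurable B ->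
    P [set w | B [tuple Y i w | i < n] /\
               forall j : 'I_n, (j <= k)%N -> sigma w j = s j] =
    (\int[P]_(w in [set w | B [tuple Y i w | i < n] /\
                     forall j : 'I_n, (j < k)%N -> sigma w j = s j])
       (Y (s k) w /
          (\sum_(i < n) Y i w - \sum_(j < n | (j < k)%N) Y (s j) w))%:E)%E.

Definition size_biased_permutation Y X : Prop :=
  exists2 sigma : Omega -> 'S_n,
    size_biased_choice Y sigma & forall i w, X i w = Y (sigma w i) w.

End random_sequences.

(* Main.v *)
(* Attach to the values y_i independent exponential clocks of rates y_i: the
   order in which they ring is a size-biased permutation, and the set of clocks
   still silent at time t contains each i independently with probability
   exp (- t y_i).  Hence, with t such that phi(t) = u, about n u values survive
   until time t, and their empirical distribution is close to F_u.

   The clocks are not constructed.  Given y, only the following comparison is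
   used: the probability that the jump chain which removes i from a set T with
   probability y_i / y(T) never visits a family of "typical" sets is a
   subharmonic function of the starting set, so its expectation at the random
   set of survivors is nondecreasing in t; at t = 0 it is the probability that
   the successive remaining sets of the permutation are never typical, and at
   any time t it is at most the probability that the survivors are not typical.
   The latter is exponentially small in n by a Chernoff bound, and the
   Borel-Cantelli lemma applies whatever the joint law for different n.  Since
   the count of the last m values in a set is 1-Lipschitz in m, this fixes the
   count for m = floor (n u).  Uniformity follows from monotonicity, using
   finitely many levels u and quantiles of F. *)
From HB Require Import structures.
Require Import Defs.
From mathcomp Require Import measurable_realfun ring lra.

Set Implicit Arguments.
Unset Strict Implicit.
Unset Printing Implicit Defensive.

Local Open Scope ring_scope.

(** * Exponential clocks *)

Lemma is_derive_prod_seq (R : realType) (I : eqType) (r : seq I)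
    (g : I -> R -> R) (g' : I -> R) (x : R) : uniq r -> (forall i, is_derive x 1 (g i) (g' i)) ->
  is_derive x 1 (fun t => \prod_(i <- r) g i t)
    (\sum_(i <- r) g' i * \prod_(j <- r | j != i) g j x).
Proof.
move=> + dg; elim: r => [_|a r IH /= /andP[ar ur]].
  rewrite big_nil.
  under eq_fun do rewrite big_nil.
  exact: is_derive_cst.
under eq_fun do rewrite big_cons.
have {IH}dr := IH ur.
apply: is_derive_eq (is_deriveM (dg a) dr) _.
rewrite big_cons addrC /GRing.scale/=. congr (_ + _).
  rewrite mulrC big_cons eqxx/=; congr (_ * _).
  rewrite [LHS]big_seq [RHS]big_seq_cond.
  apply: eq_big => i; last by [].
  by case: (boolP (i \in r)) => //= ir; apply/esym; apply: contraNneq ar => <-.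
rewrite mulr_sumr [LHS]big_seq [RHS]big_seq; apply: eq_bigr => i ir.
rewrite big_cons ifT; last by apply: contraNneq ar => ->.
by ring.
Qed.

Section exponential_race.
Context {R : realType} {I : finType}.
Implicit Types (y q : I -> R) (T : {set I}) (v : {set I} -> R).

(** The probability that [T] is exactly the set of survivors when each [i] survives independently
    with probability [q i]. *)
Definition survival_weight q T : R := \prod_i (if i \in T then q i else 1 - q i).

Lemma survival_weight_ge0 q T : (forall i, 0 <= q i <= 1) ->
  0 <= survival_weight q T.
Proof.
move=> q01; apply: prodr_ge0 => i _; have /andP[q0 q1] := q01 i.
by case: ifP => // _; rewrite subr_ge0.
Qed.

Lemma survival_weight1 T : survival_weight (fun=> 1) T = (T == [set: I])%:R.
Proof.
case: eqP => [->|/eqP T1].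
  by rewrite /survival_weight big1 // => i _; rewrite inE.
have [i iT] : exists i, i \notin T.
  apply/existsP; rewrite -negb_forall; apply: contra T1 => /forallP TT.
  by apply/eqP/setP => i; rewrite inE TT.
by rewrite /survival_weight (bigD1 i) //= (negbTE iT) subrr mul0r.
Qed.

(** Kolmogorov's forward equation: the expectation of [v] at the set of survivors has as derivative
    the expectation of the generator applied to [v]. *)
Lemma derive_survival y v (t : R) :
  is_derive t 1
    (fun t => \sum_T survival_weight (fun i => expR (- (t * y i))) T * v T)
    (\sum_T survival_weight (fun i => expR (- (t * y i))) T *
       \sum_(i in T) y i * (v (T :\ i) - v T)).
Proof.
pose q i t := expR (- (t * y i)).
have dq i : is_derive t 1 (q i) (- y i * q i t).
  have -> : q i = expR \o (fun s => - (s * y i)) by [].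
  have d1 : is_derive t 1 (fun s => - (s * y i)) (- y i).
    have -> : (fun s => - (s * y i)) = (fun s => - y i * s).
      by apply/funext => s; ring.
    have := @is_deriveZ _ _ _ id (- y i) t 1 1 (is_derive_id _ _).
    by rewrite /GRing.scale/= mulr1.
  have d2 := is_derive_expR (- (t * y i)).
  rewrite mulrC; exact: (@is_derive1_comp _ expR (fun s => - (s * y i)) t _ _ d2 d1).
pose Q T i t := if i \in T then q i t else 1 - q i t.
pose Q' T i := if i \in T then - y i * q i t else y i * q i t.
have dQ T i : is_derive t 1 (Q T i) (Q' T i).
  rewrite /Q /Q'; case: ifP => _; first exact: dq.
  have := is_deriveB (is_derive_cst (1 : R) t 1) (dq i).
  by rewrite sub0r mulNr opprK.
have dW T : is_derive t 1 (fun t => v T * \prod_i Q T i t)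
    (v T * \sum_i Q' T i * \prod_(j | j != i) Q T j t).
  have := is_derive_prod_seq (index_enum_uniq I) (dQ T).
  by move=> /(@is_deriveZ _ _ _ _ (v T) t 1 _).
have -> : (fun t => \sum_T survival_weight (fun i => expR (- (t * y i))) T * v T)
  = (fun t => \sum_(T <- index_enum {set I}) v T * \prod_i Q T i t).
  by apply/funext => s; apply: eq_bigr => T _; rewrite mulrC.
have dS (r : seq {set I}) : is_derive t 1 (fun t => \sum_(T <- r) v T * \prod_i Q T i t)
    (\sum_(T <- r) v T * \sum_i Q' T i * \prod_(j | j != i) Q T j t).
  elim: r => [|T r IH].
    under eq_fun do rewrite big_nil.
    by rewrite big_nil; exact: is_derive_cst.
  under eq_fun do rewrite big_cons.
  rewrite big_cons.
  exact: is_deriveD (dW T) IH.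
apply: is_derive_eq (dS _) _.
under eq_bigr do rewrite mulr_sumr.
rewrite exchange_big/=.
under [RHS]eq_bigr => T _ do (rewrite mulr_sumr big_mkcond).
rewrite [RHS]exchange_big/=; apply: eq_bigr => i _.
rewrite -big_mkcond/= (bigID (fun T : {set I} => i \in T))/=.
(* Differentiating in the clock [i] gives opposite signs on the sets with and without [i]. Writing
   the latter as [T :\ i] pairs the terms into the differences [v (T :\ i) - v T]. *)
rewrite [X in _ + X](reindex_onto (fun T => T :\ i) (fun T => i |: T)) /=; last first.
  by move=> T iT; rewrite finset.setU1K.
rewrite [X in _ + X](eq_bigl (fun T : {set I} => i \in T)); last first.
  move=> T; rewrite !inE eqxx /=; apply/eqP/idP => [<-|iT]; first by rewrite !inE eqxx.
  by rewrite finset.setD1K.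
rewrite -big_split/=; apply: eq_bigr => T iT.
rewrite /Q' !inE iT eqxx/=.
rewrite [X in _ + _ * (_ * X)](eq_bigr (fun j => Q T j t)); last first.
  by move=> j ji; rewrite /Q !inE ji.
rewrite /survival_weight [in RHS](bigD1 i)//= iT /Q /q.
by ring.
Qed.

(* Let [v] be subharmonic for the jump chain that removes from [T] the element
   [i] with probability proportional to [y i]. The set of the clocks that have
   not rung at time [t], when clock [i] rings at rate [y i], performs the same
   jumps in continuous time, so the expectation of [v] is nondecreasing in
   [t]. *)
Lemma subharmonic_le_survival y v (t : R) : (forall i, 0 <= y i) -> 0 <= t ->
  (forall T, 0 <= \sum_(i in T) y i * (v (T :\ i) - v T)) ->
  v [set: I] <=
  \sum_T survival_weight (fun i => expR (- (t * y i))) T * v T.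
Proof.
move=> y0 t0 sub_v.
pose f t := \sum_T survival_weight (fun i => expR (- (t * y i))) T * v T.
have -> : v [set: I] = f 0.
  rewrite /f (bigD1 [set: I])//= big1 ?addr0; last first.
    move=> T /negbTE T1.
    under [X in survival_weight X]eq_fun do rewrite mul0r oppr0 expR0.
    by rewrite survival_weight1 T1 mul0r.
  under [X in survival_weight X]eq_fun do rewrite mul0r oppr0 expR0.
  by rewrite survival_weight1 eqxx mul1r.
have df x := derive_survival y v x.
rewrite -/(f t).
have cf : continuous f.
  by move=> x; apply/differentiable_continuous/derivable1_diffP; have [] := df x.
have [->//|tn0] := eqVneq t 0.
have tgt0 : 0 < t by rewrite lt_neqAle eq_sym tn0.
have [x + e] := @MVT R f _ 0 t tgt0 (fun x _ => df x) (continuous_subspaceT cf).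
move=> /[!in_itv]/= /andP[x0 _].
rewrite -subr_ge0 e mulr_ge0 ?subr0//; apply: sumr_ge0 => T _; rewrite mulr_ge0//.
apply: survival_weight_ge0 => i.
by rewrite expR_ge0 -expR0 ler_expR oppr_le0 mulr_ge0// ltW.
Qed.

End exponential_race.

(** * Avoidance probabilities of the jump chain *)

Section miss.
Context {R : realType} {I : finType}.
Implicit Types (G : {set I} -> bool) (y : I -> R) (S T : {set I}).

(* Given the weights [y], the probability that the jump chain started at [S]
   avoids [G] during [m] steps; it is [0] once the weights of the current set
   sum to [0]. *)
Fixpoint miss G y (m : nat) S : R :=
  if G S then 0 else
  if m is m'.+1 then
    \sum_(i in S) y i / (\sum_(l in S) y l) * miss G y m' (S :\ i)
  else 1.

Lemma miss_ge0 G y m S : (forall i, 0 <= y i) -> 0 <= miss G y m S.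
Proof.
move=> y0; elim: m S => [|m IH] S /=; case: ifP => // _.
by apply: sumr_ge0 => i _; rewrite mulr_ge0// divr_ge0// sumr_ge0.
Qed.

Lemma miss_le G y m S : (forall i, 0 <= y i) -> miss G y m S <= (~~ G S)%:R.
Proof.
move=> y0; elim: m S => [|m IH] S /=; case: ifP => //= _.
have [S0|S0] := eqVneq (\sum_(l in S) y l) 0.
  by rewrite big1// => i _; rewrite S0 invr0 mulr0 mul0r.
rewrite -[leRHS](divff S0) mulr_suml; apply: ler_sum => i _.
rewrite -[leRHS]mulr1 ler_wpM2l//; last by rewrite (le_trans (IH _))// lern1 leq_b1.
by rewrite divr_ge0// sumr_ge0.
Qed.

(** With [#|S|] steps to go the chain runs until [S] is exhausted, so [v] depends on the set alone.
    A first-step decomposition makes it harmonic where [G] fails, and it vanishes where [G] holds;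
    hence it is subharmonic. *)
Lemma miss_le_survival G y (t : R) : (forall i, 0 <= y i) -> 0 <= t ->
  miss G y #|I| [set: I] <=
  \sum_T survival_weight (fun i => expR (- (t * y i))) T * (~~ G T)%:R.
Proof.
move=> y0 t0; pose v S := miss G y #|S| S.
rewrite -cardsT -[leLHS]/(v [set: I]).
apply: le_trans (subharmonic_le_survival y0 t0 _) _; last first.
  apply: ler_sum => T _; rewrite ler_wpM2l ?miss_le//.
  apply: survival_weight_ge0 => i.
  by rewrite expR_ge0 -expR0 ler_expR oppr_le0 mulr_ge0.
move=> T; under eq_bigr do rewrite mulrBr.
rewrite sumrB subr_ge0 -mulr_suml.
rewrite /v; case cT : #|T| => [|m].
  rewrite (cards0_eq cT) big_set0 mul0r.
  by apply: sumr_ge0 => i _; rewrite mulr_ge0// miss_ge0.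
rewrite /=; case: ifP => _.
  by rewrite mulr0; apply: sumr_ge0 => i _; rewrite mulr_ge0// miss_ge0.
have [S0|S0] := eqVneq (\sum_(l in T) y l) 0.
  by rewrite S0 mul0r; apply: sumr_ge0 => i _; rewrite mulr_ge0// miss_ge0.
rewrite mulr_sumr; apply: ler_sum => i iT.
have -> : #|T :\ i| = m by move: cT; rewrite (cardsD1 i) iT => -[].
by rewrite mulrA mulrC mulrCA mulrC mulrA mulfVK// mulrC.
Qed.

End miss.

(** * Remaining index sets and histories of a permutation *)

Section remaining.
Context {n : nat}.
Implicit Types (s : 'S_n) (k : nat).

Definition remaining k s : {set 'I_n} := [set s j | j : 'I_n & (k <= j)%N].

Lemma mem_remaining k s j : (s j \in remaining k s) = (k <= j)%N.
Proof. by rewrite mem_imset ?inE//; exact: perm_inj. Qed.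

Lemma remaining0 s : remaining 0 s = [set: 'I_n].
Proof.
apply/setP => i; rewrite inE -(permKV s i) mem_remaining.
by [].
Qed.

Lemma remaining_n s : remaining n s = finset.set0.
Proof.
apply/setP => i; rewrite inE -(permKV s i) mem_remaining.
by rewrite leqNgt ltn_ord.
Qed.

Lemma card_remaining k s : #|remaining k s| = (n - k)%N.
Proof.
rewrite card_imset; last exact: perm_inj.
rewrite -sum1_card big_mkcond/=; under eq_bigr do rewrite inE.
elim: n => [|m IH]; first by rewrite big_ord0.
rewrite big_ord_recr/= IH.
have [km|mk] := leqP k m; first by rewrite subSn ?addn1.
have /eqP -> : (m - k == 0)%N by rewrite subn_eq0 ltnW.
by have /eqP -> : (m.+1 - k == 0)%N by rewrite subn_eq0.
Qed.

Definition agree k s s' : bool := [forall j : 'I_n, (j < k)%N ==> (s j == s' j)].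

Lemma agreeP k s s' : reflect (forall j : 'I_n, (j < k)%N -> s j = s' j) (agree k s s').
Proof.
apply: (iffP forallP) => [h j jk|h j]; first by have := h j; rewrite jk => /eqP.
by apply/implyP => /h ->.
Qed.

Lemma agree_remaining k s s' : agree k s s' -> remaining k s = remaining k s'.
Proof.
suff H (r r' : 'S_n) : agree k r r' -> remaining k r \subset remaining k r'.
  move=> ss'; apply/eqP; rewrite finset.eqEsubset !H//.
  by apply/agreeP => j jk; apply/esym; exact: (agreeP _ _ _ ss').
move=> /agreeP rr'; apply/fintype.subsetP => i.
have [j ->] : exists j, i = r j by exists ((r^-1)%g i); rewrite permKV.
have [j' e] : exists j', r j = r' j' by exists ((r'^-1)%g (r j)); rewrite permKV.
rewrite mem_remaining => kj; rewrite e mem_remaining leqNgt; apply/negP => h.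
by move: e; rewrite -rr'// => /perm_inj ejj'; move: h; rewrite -ejj' ltnNge kj.
Qed.

(** In [size_biased_choice] a history is encoded by a permutation with the right first values. For
    [i] in [remaining k s], [redirect] keeps the history of [s] before [k] and makes [i] the next
    choice. *)
Definition redirect (s : 'S_n) (k i : 'I_n) : 'S_n := (s * tperm (s k) i)%g.

Lemma redirect_at s (k i : 'I_n) : redirect s k i k = i.
Proof. by rewrite permM tpermL. Qed.

Lemma redirect_before s (k i j : 'I_n) : i \in remaining k s -> (j < k)%N ->
  redirect s k i j = s j.
Proof.
move=> iS jk; rewrite permM tpermD//.
  by apply: contraTneq jk => /perm_inj <-; rewrite ltnn.
by apply: contraTneq iS => ->; rewrite mem_remaining -ltnNge.
Qed.

Lemma remainingS s (k : 'I_n) : remaining k.+1 s = remaining k s :\ s k.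
Proof.
apply/setP => i; rewrite !inE -(permKV s i) !mem_remaining (inj_eq perm_inj).
rewrite ltn_neqAle eq_sym.
by [].
Qed.

End remaining.

Local Open Scope classical_set_scope.
Local Open Scope ring_scope.

(** * Integrals and independence *)

Section integral_comp.
Import HBNNSimple.
Context {R : realType} d d' (T : measurableType d) (E : measurableType d').
Variable mu : {measure set T -> \bar R}.
Variables (a b : T -> R) (X : T -> E).
Hypotheses (ma : measurable_fun setT a) (mb : measurable_fun setT b).
Hypotheses (a0 : forall w, 0 <= a w) (b0 : forall w, 0 <= b w).
Hypothesis mX : measurable_fun setT X.
Hypothesis eq_ab : forall B, measurable B ->
  (\int[mu]_w (a w * \1_B (X w))%:E = \int[mu]_w (b w * \1_B (X w))%:E)%E.

Let nnsfun_case (f : {nnsfun E >-> R}) :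
  (\int[mu]_w (a w * f (X w))%:E = \int[mu]_w (b w * f (X w))%:E)%E.
Proof.
have dec (c : T -> R) : measurable_fun setT c -> (forall w, 0 <= c w) ->
    (\int[mu]_w (c w * f (X w))%:E = \sum_(r \in range f)
      r%:E * \int[mu]_w (c w * \1_(f @^-1` [set r]) (X w))%:E)%E.
  move=> mc c0.
  under eq_integral do rewrite fimfunE mulrC mulr_fsuml// -fsumEFin//.
  rewrite ge0_integral_fsum//=.
  - apply: eq_fsbigr => r /[!inE] -[z _ <-].
    under eq_integral do rewrite mulrC mulrCA EFinM.
    rewrite ge0_integralZl//=.
    + apply/measurable_EFinP/measurable_funM => //.
      apply: measurableT_comp => //; exact: measurable_indic.
    + by move=> w _; rewrite lee_fin mulr_ge0.
    + by rewrite lee_fin.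
  - move=> r; apply/measurable_EFinP/measurable_funM => //.
    apply: measurable_funM => //.
    apply: measurableT_comp => //; exact: measurable_indic.
  - move=> r w _.
    rewrite lee_fin indicE; case: (boolP (X w \in _)) => [|_]; last first.
      by rewrite mulr0 mul0r.
    by rewrite inE /= => <-; rewrite mulr1 mulr_ge0.
rewrite (dec a)// (dec b)//; apply: eq_fsbigr => r _; congr (_ * _)%E.
by apply: eq_ab; exact: measurable_funPTI.
Qed.

(** The identity passes from indicators to simple functions, then to [f] by monotone convergence. It
    lets a factor be replaced by another one with the same conditional expectation given [X]. *)
Lemma ge0_integral_comp_eq (f : E -> R) : measurable_fun setT f -> (forall z, 0 <= f z) ->
  (\int[mu]_w (a w * f (X w))%:E = \int[mu]_w (b w * f (X w))%:E)%E.
Proof.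
move=> mf f0.
have mf' : measurable_fun setT (EFin \o f) by exact/measurable_EFinP.
pose f_ := nnsfun_approx measurableT mf'.
have lim_c (c : T -> R) : measurable_fun setT c -> (forall w, 0 <= c w) ->
    (\int[mu]_w (c w * f (X w))%:E = limn (fun n => \int[mu]_w (c w * f_ n (X w))%:E))%E.
  move=> mc c0.
  rewrite -monotone_convergence//.
  - apply: eq_integral => w _; apply/esym/cvg_lim => //.
    under eq_fun do rewrite EFinM.
    rewrite EFinM; apply: cvgeZl => //.
    apply: cvg_nnsfun_approx => //= z _; by rewrite lee_fin.
  - move=> n; apply/measurable_EFinP/measurable_funM => //.
    exact: measurableT_comp.
  - by move=> n w _; rewrite lee_fin mulr_ge0.
  - move=> w _ m n mn; rewrite lee_fin ler_wpM2l//.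
    exact/lefP/nd_nnsfun_approx.
rewrite (lim_c a)// (lim_c b)//; congr (limn _).
by apply/funext => n; exact: nnsfun_case.
Qed.

End integral_comp.

Section iid_product.
Context {R : realType} {d : measure_display} {Omega : measurableType d}.
Variables (P : probability Omega R) (F : probability R R).

Lemma integral_distribution_eq (Z : {RV P >-> R}) (f : R -> R) :
  (forall A, measurable A -> distribution P Z A = F A) ->
  measurable_fun setT f -> (forall x, 0 <= f x) ->
  (\int[P]_w (f (Z w))%:E = \int[F]_x (f x)%:E)%E.
Proof.
move=> ZF mf f0.
transitivity (\int[distribution P Z]_x (f x)%:E)%E; last first.
  by apply: eq_measure_integral => A mA _; exact: ZF.
by rewrite ge0_integral_distribution//; exact/measurable_EFinP.
Qed.

Lemma iid_integral_prod n (Y : 'I_n -> {RV P >-> R}) (f : 'I_n -> R -> R)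
    (m : 'I_n -> R) :
  mutually_independent Y ->
  (forall i (A : set R), measurable A -> distribution P (Y i) A = F A) ->
  (forall i, measurable_fun setT (f i)) -> (forall i x, 0 <= f i x) ->
  (forall i, \int[F]_x (f i x)%:E = (m i)%:E)%E ->
  (\int[P]_w (\prod_i f i (Y i w))%:E = (\prod_i m i)%:E)%E.
Proof.
move=> indY YF mf f0 fm.
(* Independence speaks of events, that is, of indicators. Induction on [j] frees the factors of
   index below [j] one at a time, the others remaining indicators. *)
suff H (j : nat) : (j <= n)%N -> forall (f : 'I_n -> R -> R) (m : 'I_n -> R),
    (forall i, measurable_fun setT (f i)) -> (forall i x, 0 <= f i x) ->
    (forall i, \int[F]_x (f i x)%:E = (m i)%:E)%E ->
    (forall i : 'I_n, (j <= i)%N -> exists2 A, measurable A & f i = \1_A) ->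
    (\int[P]_w (\prod_i f i (Y i w))%:E = (\prod_i m i)%:E)%E.
  by apply: (H n) => // i; rewrite leqNgt ltn_ord.
elim: j => [_|j IH jn] {}f {}m {}mf {}f0 {}fm fA.
  have /choice[A {}fA] : forall i, exists A, measurable A /\ f i = \1_A.
    by move=> i; have [A mA fi] := fA i (leq0n i); exists A.
  have mE i : (m i)%:E = P (Y i @^-1` A i).
    rewrite -fm; have [mA ->] := fA i; rewrite integral_indic// setIT.
    by apply/esym; exact: YF.
  transitivity (P (\bigcap_(i in [set` [set: 'I_n]%SET]) (Y i @^-1` A i))).
    set X := (X in P X).
    have mX : measurable X.
      apply: fin_bigcap_measurable => [|i _]; first exact: finite_finset.
      by apply: measurable_funPTI; have [] := fA i.
    transitivity (\int[P]_w (\1_X w)%:E)%E; last by rewrite integral_indic// setIT.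
    apply: eq_integral => w _; congr EFin.
    rewrite indicE; case: (boolP (w \in _)) => [|].
      rewrite inE => wA; apply: big1 => i _; have [_ ->] := fA i.
      by rewrite indicE mem_set//; apply: wA; rewrite /= inE.
    move=> /negP wA.
    have [i wAi] : exists i, ~ A i (Y i w).
      by apply/existsNP => wA'; apply: wA; rewrite inE => i _; exact: wA'.
    have [_ fi] := fA i.
    by rewrite (bigD1 i)//= fi indicE memNset// mul0r.
  rewrite indY; last by move=> i _; have [] := fA i.
  rewrite (eq_bigr (fun i => (m i)%:E)); last by move=> i _; rewrite mE.
  rewrite -(big_morph EFin EFinM erefl); congr EFin; apply: eq_bigl => i; by rewrite inE.
pose i0 := Ordinal jn.
have m0 i : 0 <= m i.
  by rewrite -lee_fin -fm integral_ge0// => x _; rewrite lee_fin.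
pose a w := \prod_(i | i != i0) f i (Y i w).
pose b (w : Omega) := \prod_(i | i != i0) m i.
have ma : measurable_fun setT a.
  rewrite /a; under eq_fun do rewrite -big_filter.
  by apply: measurable_prod => i _; apply: measurableT_comp.
have a0 w : 0 <= a w by apply: prodr_ge0.
have b0 w : 0 <= b w by apply: prodr_ge0.
transitivity (\int[P]_w (a w * f i0 (Y i0 w))%:E)%E.
  by apply: eq_integral => w _; rewrite (bigD1 i0)//= mulrC.
rewrite (@ge0_integral_comp_eq _ _ _ _ _ P a b (Y i0))//.
  rewrite /b; under eq_integral do rewrite EFinM.
  rewrite ge0_integralZl//=; last 3 first.
  - by apply/measurable_EFinP; apply: measurableT_comp.
  - by move=> w _; rewrite lee_fin.
  - by rewrite lee_fin prodr_ge0.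
  rewrite (integral_distribution_eq (f := f i0))//; last exact: YF.
  by rewrite fm -EFinM mulrC [in RHS](bigD1 i0).
  exact: measurable_cst.
move=> B mB.
(* To compare [a] with its mean on the event that [Y i0] lies in [B], the factor [i0] is replaced by
   [\1_B]; the induction hypothesis then applies. *)
pose f' i := if i == i0 then \1_B else f i.
pose m' i := if i == i0 then fine (F B) else m i.
have IH' := IH (ltnW jn) f' m'.
have mE : \prod_i m' i = fine (F B) * \prod_(i | i != i0) m i.
  rewrite (bigD1 i0)//= {1}/m' eqxx; congr (_ * _).
  by apply: eq_bigr => i /negbTE ii0; rewrite /m' ii0.
transitivity (\int[P]_w (\prod_(i < n) f' i (Y i w))%:E)%E.
  apply: eq_integral => w _; rewrite (bigD1 i0)//= {1}/f' eqxx mulrC; congr (_ * _)%:E.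
  by apply: eq_bigr => i /negbTE ii0; rewrite /f' ii0.
rewrite {}IH' ?mE.
- rewrite /b; under eq_integral do rewrite EFinM.
  rewrite ge0_integralZl//=; last 2 first.
  + by apply/measurable_EFinP; apply: measurableT_comp.
  + by rewrite lee_fin prodr_ge0.
  rewrite (integral_distribution_eq (f := \1_B))//; last exact: YF.
  rewrite integral_indic// setIT EFinM fineK ?fin_num_measure// muleC.
  by [].
- by move=> i; rewrite /f'; case: ifP.
- by move=> i x; rewrite /f'; case: ifP.
- move=> i; rewrite /f' /m'; case: ifP => // _.
  by rewrite integral_indic// setIT fineK// fin_num_measure.
- move=> i ji; rewrite /f'; case: ifPn => [_|ii0]; first by exists B.
  apply: fA; rewrite ltn_neqAle ji andbT.
  by apply: contra ii0 => /eqP e; apply/eqP/val_inj.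
Qed.

End iid_product.

(** * Concentration of the surviving values *)

Section clock.
Context {R : realType}.
Implicit Types (t x : R) (F : probability R R).

Lemma probability_integral_cst F (r : R) : (\int[F]_x r%:E = r%:E)%E.
Proof.
rewrite integral_cst// -[RHS]mule1; congr (_ * _)%E; exact: probability_setT.
Qed.

(* The truncation at [0] makes this bounded on the whole line, the values being
   positive only almost surely. *)
Definition clock t x : R := expR (- (t * Num.max x 0)).

Lemma measurable_clock t : measurable_fun setT (clock t).
Proof.
apply: measurableT_comp => //; apply: measurableT_comp => //.
by apply: measurable_funM => //; exact: measurable_funrpos.
Qed.

Lemma clock_ge0 t x : 0 <= clock t x. Proof. exact: expR_ge0. Qed.

Lemma clock_le1 t x : 0 <= t -> clock t x <= 1.
Proof.
by move=> t0; rewrite -expR0 ler_expR oppr_le0 mulr_ge0// le_max lexx orbT.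
Qed.

(** When [F] is carried by the positive half-line, [survival F t setT] is the Laplace transform at
    [t], and [survival F t A / survival F t setT] is the tilted mass of [A] at the level
    [u = survival F t setT]. *)
Definition survival F t (A : set R) : R := \int[F]_x (clock t x * \1_A x).

Lemma survivalE F t A : 0 <= t -> measurable A ->
  (\int[F]_x (clock t x * \1_A x)%:E = (survival F t A)%:E)%E.
Proof.
move=> t0 mA; rewrite /survival /Rintegral fineK// ge0_fin_numE; last first.
  by apply: integral_ge0 => x _; rewrite lee_fin mulr_ge0// clock_ge0.
apply: (@le_lt_trans _ _ (\int[F]_x (cst 1%:E x))%E); last first.
  by rewrite probability_integral_cst ltry.
apply: ge0_le_integral => //.
- by move=> x _; rewrite lee_fin mulr_ge0// clock_ge0.
- by apply/measurable_EFinP/measurable_funM => //; exact: measurable_clock.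
- move=> x _; rewrite lee_fin -[leRHS]mulr1 ler_pM ?clock_ge0 ?clock_le1//.
Qed.

Lemma survival_ge0 F t A : 0 <= survival F t A.
Proof.
apply: fine_ge0; apply: integral_ge0 => x _; rewrite lee_fin mulr_ge0//.
exact: clock_ge0.
Qed.

Lemma survival_le F t A B : 0 <= t -> measurable A -> measurable B -> A `<=` B ->
  survival F t A <= survival F t B.
Proof.
move=> t0 mA mB AB; rewrite -lee_fin -!survivalE//.
apply: ge0_le_integral => //.
- by move=> x _; rewrite lee_fin mulr_ge0// clock_ge0.
- by apply/measurable_EFinP/measurable_funM => //; exact: measurable_clock.
- by apply/measurable_EFinP/measurable_funM => //; exact: measurable_clock.
- move=> x _; rewrite lee_fin ler_wpM2l ?clock_ge0//.
  rewrite !indicE; case: (boolP (x \in A)) => // /set_mem Ax.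
  by rewrite mem_set//; apply: AB.
Qed.

Lemma survival_le1 F t A : 0 <= t -> measurable A -> survival F t A <= 1.
Proof.
move=> t0 mA; rewrite -lee_fin -survivalE//.
rewrite -(probability_integral_cst F).
apply: ge0_le_integral => //.
- by move=> x _; rewrite lee_fin mulr_ge0// clock_ge0.
- by apply/measurable_EFinP/measurable_funM => //; exact: measurable_clock.
- move=> x _; rewrite lee_fin -[leRHS]mulr1 ler_pM ?clock_ge0 ?clock_le1//.
Qed.

End clock.

(** With [w = 2 * z ^+ 2 - z], the bound [1 + w <= expR w] reduces the claim to
    [1 <= (1 + z) * (1 + w)], and this product equals [1 + z ^+ 2 * (1 + 2 * z)]. *)
Lemma expR_sub_sqr_le (R : realType) (z : R) : - 2^-1 <= z ->
  expR (z - 2 * z ^+ 2) <= 1 + z.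
Proof.
move=> z2.
have p0 : 0 < 1 + (2 * z ^+ 2 - z) by nra.
rewrite -opprB expRN; apply: (@le_trans _ _ (1 + (2 * z ^+ 2 - z))^-1).
  by rewrite lef_pV2 ?posrE ?expR_gt0// expR_ge1Dx.
rewrite -[_^-1]mul1r ler_pdivrMr//; nra.
Qed.

Lemma sum_survival_weightM (R : realType) (I : finType) (q a b : I -> R) :
  \sum_(T : {set I}) survival_weight q T * \prod_i (if i \in T then a i else b i) =
  \prod_i (q i * a i + (1 - q i) * b i).
Proof.
rewrite bigA_distr/=; apply: eq_bigr => T _.
rewrite /survival_weight -big_split/=; apply: eq_bigr => i _.
by case: ifP.
Qed.

Section chernoff.
Context {R : realType} {d : measure_display} {Omega : measurableType d}.
Variables (P : probability Omega R) (F : probability R R).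

Lemma measurable_deviation n (Y : 'I_n -> {RV P >-> R}) (t s c e : R) (A : set R) :
  measurable A ->
  measurable_fun setT (fun w => \sum_(T : {set 'I_n})
    survival_weight (fun i => clock t (Y i w)) T *
    (e < s * (\sum_(i in T) \1_A (Y i w) - c))%R%:R : R).
Proof.
move=> mA; apply: measurable_sum => T.
apply: measurable_funM.
  apply: measurable_prod => i _; case: (i \in T).
    exact: (measurableT_comp (measurable_clock t)).
  by apply: measurable_funB => //; exact: (measurableT_comp (measurable_clock t)).
apply: (@measurableT_comp _ _ _ _ _ _ (fun b : bool => b%:R : R)) => //.
apply: measurable_fun_ltr => //; apply: measurable_funM => //.
apply: measurable_funB => //.
under eq_fun do rewrite -big_filter.
apply: measurable_sum => i; exact: measurableT_comp.
Qed.

(** In place of an exponential moment, the proof uses the product over [i] of [1 + th * x i], where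
    [x i] is the centred contribution of [i] to the count. Its expectation is exactly [1] by
    independence, and it is at least [expR (n * eps ^+ 2 / 8)] on the deviation event. The sign [s]
    selects the tail. *)
Lemma survival_chernoff n (Y : 'I_n -> {RV P >-> R}) (t eps s : R) (A : set R) :
  mutually_independent Y ->
  (forall i (B : set R), measurable B -> distribution P (Y i) B = F B) ->
  0 <= t -> 0 < eps -> eps <= 1 -> `|s| = 1 -> measurable A ->
  (\int[P]_w (\sum_(T : {set 'I_n}) survival_weight (fun i => clock t (Y i w)) T *
     (n%:R * eps < s * (\sum_(i in T) \1_A (Y i w) - n%:R * survival F t A))%R%:R)%:E
   <= (expR (- (n%:R * eps ^+ 2 / 8)))%:E)%E.
Proof.
move=> indY YF t0 e0 e1 s1 mA.
(* In absolute value, [eps / 4] maximizes the exponent [th * n * eps - 2 * n * th ^+ 2], with value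
   [n * eps ^+ 2 / 8]. As [eps <= 1], it is at most [1 / 4], which keeps all factors positive. *)
set g := survival F t A; pose th := s * (eps / 4).
have g0 : 0 <= g by exact: survival_ge0.
have g1 : g <= 1 by exact: survival_le1.
have th2 : th ^+ 2 = eps ^+ 2 / 16.
  by rewrite /th exprMn -[s ^+ 2]real_normK ?num_real// s1; field.
have th4 : `|th| <= 4^-1.
  by rewrite /th normrM s1 mul1r ger0_norm; lra.
pose f (i : 'I_n) x :=
  clock t x * (1 + th * (\1_A x - g)) + (1 - clock t x) * (1 - th * g).
have A01 x : 0 <= (\1_A x : R) <= 1.
  by rewrite indicE; case: (_ \in _); rewrite ?lexx ?ler01.
have hth z : -1 <= z -> z <= 1 -> - 2^-1 <= th * z.
  move=> z0 z1; have : `|th * z| <= 4^-1.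
    rewrite normrM -[leRHS]mulr1 ler_pM//; by rewrite ler_norml z0 z1.
  by rewrite ler_norml => /andP[]; lra.
have f0 i x : 0 <= f i x.
  have /andP[A0 A1] := A01 x.
  have h1 := hth (\1_A x - g); have h2 := hth (- g).
  rewrite addr_ge0// mulr_ge0 ?clock_ge0 ?subr_ge0 ?clock_le1//.
    have : - 2^-1 <= th * (\1_A x - g) by apply: h1; lra.
    lra.
  have : - 2^-1 <= th * - g by apply: h2; lra.
  lra.
have fE i x : f i x = (1 - th * g) + th * (clock t x * \1_A x) by rewrite /f; ring.
have mf i : measurable_fun setT (f i).
  rewrite (funext (fE i)); apply: measurable_funD => //; apply: measurable_funM => //.
  by apply: measurable_funM => //; exact: measurable_clock.
(* The mean of [clock t x * \1_A x] is [g], so the centring cancels it exactly. *)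
have If i : (\int[F]_x (f i x)%:E = 1%:E)%E.
  have iC : F.-integrable setT (fun x => (clock t x * \1_A x)%:E).
    apply/integrableP; split.
      by apply/measurable_EFinP/measurable_funM => //; exact: measurable_clock.
    under eq_integral => x _.
      rewrite gee0_abs; last by rewrite lee_fin mulr_ge0// clock_ge0.
      over.
    by rewrite survivalE// ltry.
  under eq_integral do rewrite fE EFinD EFinM.
  rewrite integralD//=; last 2 first.
  - exact: finite_measure_integrable_cst.
  - exact: integrableZl.
  rewrite integralZl// survivalE// probability_integral_cst.
  by rewrite -EFinM -EFinD subrK.
have := iid_integral_prod indY YF mf f0 If.
rewrite big1// => Iprod.
rewrite -[leRHS]mule1 -Iprod -ge0_integralZl//=; last 2 first.
- apply/measurable_EFinP; apply: measurable_prod => i _.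
  exact: measurableT_comp.
- by move=> w _; rewrite lee_fin prodr_ge0.
apply: ge0_le_integral => //.
- move=> w _; rewrite lee_fin; apply: sumr_ge0 => T _; rewrite mulr_ge0//.
  by apply: survival_weight_ge0 => i; rewrite clock_ge0 clock_le1.
- by apply/measurable_EFinP; exact: measurable_deviation.
- apply/measurable_EFinP; apply: measurable_funM => //; apply: measurable_prod => i _.
  exact: measurableT_comp.
move=> w _; rewrite lee_fin /f -sum_survival_weightM mulr_sumr.
apply: ler_sum => T _; rewrite mulrCA ler_wpM2l//.
  by apply: survival_weight_ge0 => i; rewrite clock_ge0 clock_le1.
have fac i : - 2^-1 <= (if i \in T then th * (\1_A (Y i w) - g) else th * (0 - g)).
  have /andP[A0 A1] := A01 (Y i w).
  by case: ifP => _; apply: hth; lra.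
case: ltP => [h|_]; last first.
  rewrite mulr_ge0 ?expR_ge0//; apply: prodr_ge0 => i _.
  by move: (fac i); case: ifP => _; lra.
rewrite expRN mulrC ler_pdivlMr ?expR_gt0// mul1r.
pose x (i : 'I_n) := (if i \in T then \1_A (Y i w) else 0) - g.
apply: (@le_trans _ _ (\prod_i expR (th * x i - 2 * (th * x i) ^+ 2))); last first.
  apply: ler_prod => i _; rewrite expR_ge0/=.
  apply: le_trans (expR_sub_sqr_le _) _.
    by move: (fac i); rewrite /x; case: ifP.
  by rewrite /x; case: ifP => _; lra.
rewrite -expR_sum ler_expR.
apply: (@le_trans _ _ (\sum_(i < n) (th * x i - 2 * th ^+ 2))); last first.
  apply: ler_sum => i _; rewrite lerD2l lerN2 ler_wpM2l//.
  rewrite exprMn -[leRHS]mulr1 ler_wpM2l ?sqr_ge0//.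
  have /andP[A0 A1] := A01 (Y i w).
  have x1 : -1 <= x i by rewrite /x; case: ifP => _; lra.
  have x2 : x i <= 1 by rewrite /x; case: ifP => _; lra.
  nra.
rewrite big_split/= -mulr_sumr sumrN sumr_const card_ord th2.
have -> : \sum_i x i = \sum_(i in T) \1_A (Y i w) - n%:R * g.
  by rewrite /x sumrB -big_mkcond/= sumr_const card_ord mulr_natl.
rewrite -[2 * _ *+ n]mulr_natl; pose D := \sum_(i in T) \1_A (Y i w) - n%:R * g.
rewrite -/D in h *.
have -> : th * D = eps / 4 * (s * D) by rewrite /th; ring.
have : eps / 4 * (n%:R * eps) <= eps / 4 * (s * D).
  by rewrite ler_wpM2l ?ltW// divr_gt0.
lra.
Qed.

End chernoff.

(** * The jump chain of a size-biased choice *)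

Lemma measurable_invr (R : realType) : measurable_fun setT (@GRing.inv R).
Proof.
rewrite -(setvU [set (0 : R)]); apply/measurable_funU => //.
  exact: measurableC.
split; last exact: measurable_fun_set1.
apply: open_continuous_measurable_fun; first last.
  by move=> x; rewrite inE => /eqP; exact: inv_continuous.
apply: closed_openC; apply: accessible_closed_set1.
by apply: hausdorff_accessible; exact: norm_hausdorff.
Qed.

Section jump_chain.
Context {R : realType} {d : measure_display} {Omega : measurableType d}.
Variables (P : probability Omega R) (n : nat) (Y : 'I_n -> {RV P >-> R}).
Variables (sigma : Omega -> 'S_n) (Ysigma : size_biased_choice Y sigma).

Let Yt w : n.-tuple R := [tuple Y i w | i < n].

Let tnthYt w i : tnth (Yt w) i = Y i w. Proof. by rewrite tnth_mktuple. Qed.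

Let measurable_Yt : measurable_fun setT Yt.
Proof.
apply/measurable_fun_tnthP => i.
rewrite (_ : _ \o _ = Y i)//; by apply/funext => w; rewrite /= tnthYt.
Qed.

(** The values are positive only almost surely. Restricting to this set makes the jump weights, and
    hence [miss], nonnegative. *)
Definition positive_tuples : set (n.-tuple R) := [set y | forall i, 0 < tnth y i].

Lemma measurable_positive_tuples : measurable positive_tuples.
Proof.
rewrite (_ : positive_tuples =
    \bigcap_(i in [set: 'I_n]) ((fun y => tnth y i) @^-1` `]0, +oo[)).
  apply: fin_bigcap_measurable; first exact: finite_finset.
  move=> i _; rewrite -[X in measurable X]setTI; exact: measurable_tnth.
apply/seteqP; split=> [y y0 i _|y y0 i]; rewrite /= ?in_itv/= ?andbT//.
by have := y0 i Logic.I; rewrite /= in_itv/= andbT.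
Qed.

Lemma measurable_fun_sigma (h : 'S_n -> Omega -> R) :
  (forall s, measurable_fun setT (h s)) ->
  measurable_fun setT (fun w => h (sigma w) w).
Proof.
move=> mh; have [ms _] := Ysigma.
rewrite (_ : (fun _ => _) = fun w => \sum_s \1_(sigma @^-1` [set s]) w * h s w).
  by apply: measurable_sum => s; apply: measurable_funM.
apply/funext => w; rewrite (bigD1 (sigma w))//= indicE mem_set// mul1r big1 ?addr0//.
by move=> s ss; rewrite indicE memNset ?mul0r//= => e; rewrite e eqxx in ss.
Qed.

Let remaining_sum (s : 'S_n) (k : 'I_n) w :
  \sum_(i < n) Y i w - \sum_(j < n | (j < k)%N) Y (s j) w =
  \sum_(i in remaining k s) Y i w.
Proof.
rewrite (reindex_inj (@perm_inj _ s))/= (bigID (fun j : 'I_n => (j < k)%N))/= addrC addrK.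
rewrite big_imset/=; last by move=> i j _ _; exact: perm_inj.
by apply: eq_bigl => j; rewrite inE -leqNgt.
Qed.

(** The defining identity of [size_biased_choice] on positive values, with events turned into
    factors: this is the form of the hypothesis of [ge0_integral_comp_eq]. *)
Lemma size_biased_step (s : 'S_n) (k : 'I_n) (B : set (n.-tuple R)) : measurable B ->
  (\int[P]_w ((agree k.+1 (sigma w) s)%:R * \1_positive_tuples (Yt w) * \1_B (Yt w))%:E =
   \int[P]_w ((agree k (sigma w) s)%:R * \1_positive_tuples (Yt w) *
      (Y (s k) w / \sum_(i in remaining k s) Y i w) * \1_B (Yt w))%:E)%E.
Proof.
move=> mB; have [ms h] := Ysigma.
have /h : measurable (positive_tuples `&` B).
  by apply: measurableI => //; exact: measurable_positive_tuples.
move=> /(_ k s) {}h.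
transitivity (P [set w | (positive_tuples `&` B) (Yt w) /\
    forall j : 'I_n, (j <= k)%N -> sigma w j = s j]).
  set X := (X in P X).
  have XE w : (agree k.+1 (sigma w) s)%:R * \1_positive_tuples (Yt w) *
      \1_B (Yt w) = \1_X w :> R.
    rewrite !indicE -!natrM !mulnb; congr (nat_of_bool _)%:R.
    apply/idP/idP.
      move=> /andP[/andP[/agreeP a p] b]; rewrite inE in p; rewrite inE in b.
      by rewrite inE.
    rewrite inE => -[[p b] a]; rewrite !mem_set// !andbT.
    exact/agreeP.
  have mX : measurable X.
    apply/(@measurable_indicP _ _ R).
    rewrite -(funext XE).
      apply: measurable_funM; last by apply: measurableT_comp.
      apply: measurable_funM; last first.
        apply: measurableT_comp => //; apply: measurable_indic.
        exact: measurable_positive_tuples.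
      exact: (measurable_fun_sigma (h := fun s' _ => (agree k.+1 s' s)%:R)).
  by rewrite -[X in P X]setIT -integral_indic//; apply: eq_integral => w _; rewrite XE.
rewrite h integral_mkcond; apply: eq_integral => w _.
rewrite /patch remaining_sum; case: ifPn => [|].
  rewrite inE => -[[p b] a]; rewrite !indicE !mem_set// !mulr1.
  have -> : agree k (sigma w) s by exact/agreeP.
  by rewrite mul1r.
move=> /negP; rewrite inE => nn.
rewrite !indicE; case: (boolP (agree _ _ _)) => [a|_]; last by rewrite !mul0r.
case: (boolP (Yt w \in positive_tuples)) => [p|_]; last by rewrite mulr0 !mul0r.
case: (boolP (Yt w \in B)) => [b|_]; last by rewrite mulr0.
exfalso; apply: nn; rewrite inE in p; rewrite inE in b; split => //.
exact/agreeP.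
Qed.


Variable G : n.-tuple R -> {set 'I_n} -> bool.
Hypothesis mG : forall S, measurable_fun setT (G^~ S).

(** The index [k'] runs up to [n] included, so the full set ([k' = 0]) and the empty set ([k' = n])
    both count as visited. *)
Definition avoid k w : bool :=
  [forall k' : 'I_n.+1, (k <= k')%N ==> ~~ G (Yt w) (remaining k' (sigma w))].

Lemma measurable_miss m S :
  measurable_fun setT (fun y : n.-tuple R => miss (G y) (tnth y) m S).
Proof.
elim: m S => [|m IH] S /=; apply: measurable_fun_ifT => //.
under eq_fun do rewrite -big_filter.
apply: measurable_sum => i; apply: measurable_funM => //.
apply: measurable_funM; first exact: measurable_tnth.
apply: (measurableT_comp (@measurable_invr R)).
under eq_fun do rewrite -big_filter.
by apply: measurable_sum => j; exact: measurable_tnth.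
Qed.

Lemma avoidS (k : 'I_n) w :
  avoid k w = ~~ G (Yt w) (remaining k (sigma w)) && avoid k.+1 w.
Proof.
apply/forallP/andP => [h|[h0 /forallP h] k'].
  split; first by have := h (widen_ord (leqnSn n) k); rewrite leqnn.
  by apply/forallP => k'; apply/implyP => kk'; have := h k'; rewrite ltnW.
apply/implyP; rewrite leq_eqVlt => /orP[/eqP <-//|kk'].
by have := h k'; rewrite kk'.
Qed.

(** A history that agrees with [s] before [k] has exactly one continuation, [i = s' k]. *)
Lemma agree_sum (k : 'I_n) s s' :
  (agree k s' s)%:R =
  \sum_(i in remaining k s) (agree k.+1 s' (redirect s k i))%:R :> R.
Proof.
case: (boolP (agree k s' s)) => [a|na]; last first.
  rewrite big1// => i iS; case: (boolP (agree _ _ _)) => // /agreeP a.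
  case/agreeP: na => j jk; rewrite a ?redirect_before//; exact: ltnW.
have sS : s' k \in remaining k s by rewrite -(agree_remaining a) mem_remaining.
rewrite (bigD1 (s' k))//= big1 ?addr0.
  case: (boolP (agree _ _ _)) => // /agreeP; case=> j; rewrite ltnS leq_eqVlt.
  move=> /orP[/eqP/val_inj ->|jk]; first by rewrite redirect_at.
  by rewrite redirect_before//; exact: (agreeP _ _ _ a).
move=> i /andP[iS ni]; case: (boolP (agree _ _ _)) => // /agreeP/(_ k (leqnn _)).
by rewrite redirect_at => e; rewrite e eqxx in ni.
Qed.

Lemma measurable_avoid k : measurable_fun setT (fun w => (avoid k w)%:R : R).
Proof.
apply: (measurable_fun_sigma (h := fun s w => [forall k' : 'I_n.+1,
  (k <= k')%N ==> ~~ G (Yt w) (remaining k' s)]%:R)) => s.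
rewrite (_ : (fun _ => _) = fun w => \prod_(k' < n.+1)
    ((k <= k')%N ==> ~~ G (Yt w) (remaining k' s))%:R).
  apply: measurable_prod => k' _.
  apply: (@measurableT_comp _ _ _ _ _ _
    (fun b : bool => ((k <= k')%N ==> ~~ b)%:R : R)) => //.
  exact: (measurableT_comp (mG _)).
apply/funext => w; case: (boolP [forall k', _]) => [/forallP h|].
  by rewrite big1// => k' _; rewrite h.
rewrite negb_forall => /existsP[k' /negbTE h].
by rewrite (bigD1 k')//= h mul0r.
Qed.

(** Given the values, the remaining sets perform the jump chain. The induction is on the number [m]
    of steps left; [s] and [B] vary in it, since each step extends the history and adds a condition
    on the values. *)
Lemma avoid_miss m (k : nat) s (B : set (n.-tuple R)) : (k + m = n)%N ->
  measurable B -> B `<=` positive_tuples ->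
  (\int[P]_w ((agree k (sigma w) s)%:R * \1_B (Yt w) * (avoid k w)%:R)%:E =
   \int[P]_w ((agree k (sigma w) s)%:R *
     (\1_B (Yt w) * miss (G (Yt w)) (tnth (Yt w)) m (remaining k s)))%:E)%E.
Proof.
elim: m k s B => [|m IH] k s B kmn mB Bpos.
  rewrite addn0 in kmn; apply: eq_integral => w _; congr EFin; rewrite -mulrA.
  congr (_ * (_ * _)); rewrite kmn /= remaining_n.
  have -> : avoid n w = ~~ G (Yt w) finset.set0.
    apply/forallP/idP => [/(_ ord_max)|h k']; first by rewrite /= leqnn remaining_n.
    apply/implyP => nk'; have -> : nat_of_ord k' = n.
      by apply/eqP; rewrite eqn_leq nk' -ltnS ltn_ord.
    by rewrite remaining_n.
  by case: (G _ _).
have kn : (k < n)%N by rewrite -kmn addnS ltnS leq_addr.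
pose kk := Ordinal kn; rewrite -[k]/(nat_of_ord kk).
set S := remaining kk s.
(* The history [s] fixes the current set [S], so the failure of [G] at [S] is a condition on the
   values alone and can be merged into [B]. *)
pose B' := B `&` [set y | ~~ G y S].
have mB' : measurable B'.
  apply: measurableI => //.
  have : measurable (setT `&` (G^~ S) @^-1` [set false]) by exact: mG.
  rewrite setTI (_ : _ @^-1` _ = [set y | ~~ G y S])//.
  by apply/seteqP; split=> y /=; case: (G y S).
have B'pos : B' `<=` positive_tuples by move=> y [/Bpos].
have measA (Q : 'S_n -> bool) : measurable_fun setT (fun w => (Q (sigma w))%:R : R).
  exact: (measurable_fun_sigma (h := fun s' _ => (Q s')%:R)).
(* The event is split according to the next chosen index [i]. *)
transitivity (\int[P]_w (\sum_(i <- enum S)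
    ((agree kk.+1 (sigma w) (redirect s kk i))%:R * \1_B' (Yt w) *
       (avoid kk.+1 w)%:R)%:E))%E.
  apply: eq_integral => w _; rewrite big_enum/= sumEFin -!mulr_suml -agree_sum; congr EFin.
  rewrite -!mulrA; case: (boolP (agree _ _ _)) => [a|_]; last by rewrite !mul0r.
  rewrite (avoidS kk) (agree_remaining a) -/S.
  rewrite !indicE; congr (_ * _).
  rewrite -!natrM !mulnb andbA; congr (nat_of_bool (_ && _))%:R.
  apply/andP/idP => [[b g]|]; first by rewrite mem_set//; split => //; rewrite inE in b.
  by rewrite inE => -[b g]; rewrite mem_set.
rewrite ge0_integral_sum//; last first.
- move=> i; apply/measurable_EFinP; apply: measurable_funM; last exact: measurable_avoid.
  apply: measurable_funM; first exact: (measA (fun s' => agree _ s' _)).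
  by apply: measurableT_comp.
have f0 (i : 'I_n) z : 0 <= (\1_B' z * miss (G z) (tnth z) m (S :\ i)) :> R.
  rewrite indicE; case: (boolP (z \in B')) => [|_]; last by rewrite mul0r.
  by rewrite inE => /B'pos z0; rewrite mul1r miss_ge0// => j; rewrite ltW.
have mf i : measurable_fun setT (fun z => \1_B' z * miss (G z) (tnth z) m (S :\ i)).
  by apply: measurable_funM => //; exact: measurable_miss.
have mP : measurable_fun setT (fun w => \1_positive_tuples (Yt w) : R).
  apply: measurableT_comp => //; apply: measurable_indic.
  exact: measurable_positive_tuples.
pose b i w := (agree kk (sigma w) s)%:R * \1_positive_tuples (Yt w) *
  (Y i w / \sum_(l in S) Y l w) : R.
have b0 i w : 0 <= b i w.
  rewrite /b indicE; case: (boolP (Yt w \in _)) => [|_]; last by rewrite mulr0 mul0r.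
  rewrite inE => p; have Y0 l : 0 <= Y l w by rewrite -tnthYt ltW.
  by rewrite !mulr_ge0// invr_ge0 sumr_ge0.
have mb i : measurable_fun setT (b i).
  apply: measurable_funM.
    by apply: measurable_funM => //; exact: (measA (fun s' => agree _ s' _)).
  apply: measurable_funM => //; apply: (measurableT_comp (@measurable_invr R)).
  under eq_fun do rewrite -big_filter.
  exact: measurable_sum.
have step i : i \in S ->
  (\int[P]_w ((agree kk.+1 (sigma w) (redirect s kk i))%:R * \1_B' (Yt w) *
     (avoid kk.+1 w)%:R)%:E =
   \int[P]_w ((agree kk (sigma w) s)%:R * \1_positive_tuples (Yt w) *
     (Y i w / \sum_(l in S) Y l w) *
     (\1_B' (Yt w) * miss (G (Yt w)) (tnth (Yt w)) m (S :\ i)))%:E)%E.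
  move=> iS.
  rewrite (IH kk.+1 (redirect s kk i) B')//; last by rewrite addSnnS.
  have ar : agree kk (redirect s kk i) s by apply/agreeP => j jk; exact: redirect_before.
  have Sr : remaining kk (redirect s kk i) = S by exact: agree_remaining.
  rewrite remainingS Sr redirect_at.
  transitivity (\int[P]_w ((agree kk.+1 (sigma w) (redirect s kk i))%:R *
     \1_positive_tuples (Yt w) *
     (\1_B' (Yt w) * miss (G (Yt w)) (tnth (Yt w)) m (S :\ i)))%:E)%E.
    apply: eq_integral => w _; congr EFin; rewrite -mulrA; congr (_ * _).
    rewrite !indicE; case: (boolP (Yt w \in B')) => [|_]; last by rewrite !mul0r mulr0.
    by rewrite inE => /B'pos p; rewrite mem_set// !mul1r.
  (* The indicator of the next choice is traded for its conditional probability; the factor with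
     [miss] is a function of the values only. *)
  apply: (@ge0_integral_comp_eq _ _ _ _ _ P
    (fun w => (agree kk.+1 (sigma w) (redirect s kk i))%:R * \1_positive_tuples (Yt w))
    (b i) Yt _ _ _ _ _ _ (fun z => \1_B' z * miss (G z) (tnth z) m (S :\ i))) => //.
  + by apply: measurable_funM => //; exact: (measA (fun s' => agree _ s' _)).
  + move=> C mC; rewrite size_biased_step//; apply: eq_integral => w _.
    rewrite redirect_at Sr.
    rewrite (_ : agree kk (sigma w) (redirect s kk i) = agree kk (sigma w) s)//.
    apply/agreeP/agreeP => a j jk; by rewrite a// redirect_before.
rewrite big_enum/= (eq_bigr _ step) -big_enum -ge0_integral_sum//; last 2 first.
- move=> i; apply/measurable_EFinP; apply: measurable_funM; first exact: (mb i).
  exact: (measurableT_comp (mf i)).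
- move=> i w _; rewrite lee_fin; apply: mulr_ge0; [exact: (b0 i w)|exact: (f0 i)].
apply: eq_integral => w _; rewrite big_enum/= sumEFin; congr EFin.
under [LHS]eq_bigr do rewrite -!mulrA; rewrite -mulr_sumr; congr (_ * _).
rewrite !indicE /=; case: (boolP (Yt w \in B)) => [|nB]; last first.
  rewrite mul0r big1// => i _; rewrite [_ \in B']memNset ?mul0r ?mulr0// => -[].
  by move=> Bw; rewrite mem_set in nB.
rewrite inE => Bw; rewrite mem_set ?mul1r; last exact: Bpos.
case: ifPn => gS.
  rewrite big1// => i _; rewrite [_ \in B']memNset ?mul0r ?mulr0// => -[_].
  by rewrite /= gS.
rewrite [_ \in B']mem_set//; apply: eq_bigr => i _; rewrite !mul1r tnthYt.
by under [in RHS]eq_bigr do rewrite tnthYt; rewrite mulrA.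
Qed.

End jump_chain.

(** * Remaining sets visit a typical set with high probability *)

Section hitting.
Context {R : realType} {d : measure_display} {Omega : measurableType d}.
Variables (P : probability Omega R) (F : probability R R) (n : nat).
Variables (Y : 'I_n -> {RV P >-> R}) (sigma : Omega -> 'S_n).
Hypothesis Ysigma : size_biased_choice Y sigma.
Hypothesis indY : mutually_independent Y.
Hypothesis YF : forall i (B : set R), measurable B -> distribution P (Y i) B = F B.
Hypothesis F_pos : F `]0, +oo[%classic = 1%E.
Variables (t eps : R) (A : set R).
Hypotheses (t0 : 0 <= t) (eps0 : 0 < eps) (eps1 : eps <= 1) (mA : measurable A).

(** The condition on [#|T|] is what later turns the clock time [t] into a number of last values. *)
Definition typical (y : n.-tuple R) (T : {set 'I_n}) : bool :=
  (`|#|T|%:R - n%:R * survival F t setT| <= n%:R * eps) &&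
  (`|\sum_(i in T) \1_A (tnth y i) - n%:R * survival F t A| <= n%:R * eps).

Lemma measurable_typical S : measurable_fun setT (typical^~ S).
Proof.
apply: measurable_and => //; apply: measurable_fun_ler => //.
apply: measurableT_comp => //; apply: measurable_funB => //.
under eq_fun do rewrite -big_filter.
apply: measurable_sum => i.
apply: (@measurableT_comp _ _ _ _ _ _ (\1_A : R -> R)) => //; exact: measurable_tnth.
Qed.

(** The factor [4] counts the tails: upper and lower, for the count in [A] and for the cardinality,
    which is the count in [setT]. *)
Lemma avoid_typical_le :
  (\int[P]_w (avoid Y sigma typical 0 w)%:R%:E <=
   (4 * expR (- (n%:R * eps ^+ 2 / 8)))%:E)%E.
Proof.
set E := expR _.
pose Yt w : n.-tuple R := [tuple Y i w | i < n].
have mYt : measurable_fun setT Yt.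
  apply/measurable_fun_tnthP => i.
  by rewrite (_ : _ \o _ = Y i)//; apply/funext => w; rewrite /= tnth_mktuple.
pose dev (s : R) (B : set R) w : R := \sum_(T : {set 'I_n})
  survival_weight (fun i => clock t (Y i w)) T *
  (n%:R * eps < s * (\sum_(i in T) \1_B (Y i w) - n%:R * survival F t B))%R%:R.
have dev_le s B : measurable B -> `|s| = 1 -> (\int[P]_w (dev s B w)%:E <= E%:E)%E.
  by move=> mB s1; exact: survival_chernoff.
have mdev s B : measurable B -> measurable_fun setT (dev s B).
  by move=> mB; exact: measurable_deviation.
have dev0 s B w : 0 <= dev s B w.
  apply: sumr_ge0 => T _; rewrite mulr_ge0//; apply: survival_weight_ge0 => i.
  by rewrite clock_ge0 clock_le1.
(* The number of nonpositive values is at least [1] off [positive_tuples] and has integral [0];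
   adding it to the integrand removes the restriction to positive tuples at no cost. *)
pose neg w := \sum_(i < n) \1_(`]-oo, 0]%classic) (Y i w) : R.
have mneg : measurable_fun setT neg.
  by apply: measurable_sum => i; apply: measurableT_comp => //; exact: measurable_indic.
have neg0 w : 0 <= neg w by apply: sumr_ge0.
have Ineg : (\int[P]_w (neg w)%:E = 0)%E.
  under eq_integral do rewrite -sumEFin.
  rewrite ge0_integral_sum//; last first.
    by move=> i; apply/measurable_EFinP; apply: measurableT_comp => //; exact: measurable_indic.
  rewrite big1// => i _.
  rewrite (integral_distribution_eq (f := \1_(`]-oo, 0]%classic)) (YF i))//.
  rewrite integral_indic// setIT -setCitvr.
  by have /= -> := probability_setC F (measurable_itv `]0%R, +oo[); rewrite F_pos subee.
have mG := measurable_typical.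
have mav : measurable_fun setT (fun w => (avoid Y sigma typical 0 w)%:R : R).
  exact: measurable_avoid.
have mpos : measurable_fun setT (fun w => \1_(@positive_tuples R n) (Yt w) : R).
  by apply: measurableT_comp => //; apply: measurable_indic; exact: measurable_positive_tuples.
have main : (\int[P]_w (\1_(@positive_tuples R n) (Yt w) *
     (avoid Y sigma typical 0 w)%:R)%:E
   <= \int[P]_w (dev 1 A w + dev (-1) A w + (dev 1 setT w + dev (-1) setT w))%:E)%E.
  (* A history of length [0] is empty, so every permutation agrees with [s1]. *)
  pose s1 : 'S_n := 1%g.
  have := avoid_miss Ysigma mG s1 (add0n n) (@measurable_positive_tuples R n)
    (@subset_refl _ _).
  have ag w : agree 0 (sigma w) s1 by apply/agreeP.
  under eq_integral do rewrite ag mul1r.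
  under [in RHS]eq_integral do rewrite ag mul1r remaining0.
  move=> ->.
  apply: ge0_le_integral => //.
  - move=> w _; rewrite lee_fin indicE; case: (boolP (_ \in _)) => [|_]; last by rewrite mul0r.
    by rewrite inE mul1r => p; apply: miss_ge0 => i; rewrite ltW.
  - apply/measurable_EFinP; apply: measurable_funM => //.
    exact: (measurableT_comp (measurable_miss mG _ _)).
  - by apply/measurable_EFinP; do ?apply: measurable_funD; exact: mdev.
  move=> w _; rewrite lee_fin indicE; case: (boolP (_ \in _)) => [|_]; last first.
    by rewrite mul0r !addr_ge0.
  rewrite inE mul1r => p.
  have Y0 i : 0 < Y i w by have := p i; rewrite tnth_mktuple.
  have := miss_le_survival (typical (Yt w)) (fun i => ltW (p i)) t0.
  rewrite card_ord.
  move=> /le_trans; apply; rewrite /dev -!big_split/=; apply: ler_sum => T _.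
  rewrite (_ : survival_weight _ T = survival_weight (fun i => clock t (Y i w)) T); last first.
    congr survival_weight; apply/funext => i.
    by rewrite tnth_mktuple /clock max_l// ltW.
  rewrite -!mulrDr ler_wpM2l//.
    by apply: survival_weight_ge0 => i; rewrite clock_ge0 clock_le1.
  rewrite -!natrD ler_nat /typical negb_and -!ltNge.
  have -> : #|T|%:R = \sum_(i in T) \1_[set: R] (Y i w) :> R.
    by rewrite -sum1_card natr_sum; apply: eq_bigr => i _; rewrite indicE in_setT.
  under [\sum_(i in T) \1_A (tnth _ _)]eq_bigr do rewrite tnth_mktuple.
  rewrite !mul1r !mulN1r !ltr_normr.
  by do 4 case: (_ < _).
apply: (@le_trans _ _ (\int[P]_w ((\1_(@positive_tuples R n) (Yt w) *
    (avoid Y sigma typical 0 w)%:R)%:E + (neg w)%:E))%E).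
  apply: ge0_le_integral => //.
  - exact/measurable_EFinP.
  - apply: emeasurable_funD; first exact/measurable_EFinP/measurable_funM.
    exact/measurable_EFinP.
  move=> w _; rewrite -EFinD lee_fin indicE.
  case: (boolP (Yt w \in _)) => [_|]; first by rewrite mul1r lerDl.
  move=> /negP np; rewrite mul0r add0r.
  have [i Yi0] : exists i, Y i w <= 0.
    apply/not_existsP => h; apply: np; rewrite inE => i; rewrite tnth_mktuple ltNge.
    by apply/negP; exact: h.
  rewrite /neg (bigD1 i)//= indicE mem_set ?in_itv//=.
  by rewrite (@le_trans _ _ 1)// ?lern1 ?leq_b1// lerDl sumr_ge0.
rewrite ge0_integralD//; last 3 first.
- exact/measurable_EFinP/measurable_funM.
- by move=> w _; rewrite lee_fin.
- exact/measurable_EFinP.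
rewrite Ineg adde0; apply: le_trans main _.
have two B : measurable B ->
    (\int[P]_w (dev 1 B w + dev (-1) B w)%:E <= (2 * E)%:E)%E.
  move=> mB; under eq_integral do rewrite EFinD.
  rewrite ge0_integralD//; first last.
  - by apply/measurable_EFinP; exact: mdev.
  - by move=> w _; rewrite lee_fin.
  - by apply/measurable_EFinP; exact: mdev.
  - by move=> w _; rewrite lee_fin.
  by rewrite mulr_natl mulr2n EFinD leeD// dev_le// ?normrN normr1.
under eq_integral do rewrite EFinD.
rewrite ge0_integralD//; first last.
- by apply/measurable_EFinP; apply: measurable_funD; exact: mdev.
- by move=> w _; rewrite lee_fin addr_ge0.
- by apply/measurable_EFinP; apply: measurable_funD; exact: mdev.
- by move=> w _; rewrite lee_fin addr_ge0.
by rewrite (_ : 4 * E = 2 * E + 2 * E) ?EFinD ?leeD ?two//; ring.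
Qed.

End hitting.

(** * Counts of the last values *)

Section counting.
Context {R : realType} {n : nat}.
Implicit Types (x : 'I_n -> R) (m : nat) (A B : set R).

Definition last_count x m A : R := \sum_(j < n | (n - m <= j)%N) \1_A (x j).

Lemma sum_last_values x m A :
  \sum_(z <- last_values m x) \1_A z = last_count x m A.
Proof.
rewrite /last_values -map_drop big_map /last_count.
have -> : drop (n - m) (enum 'I_n) = [seq i : 'I_n <- enum 'I_n | (n - m <= i)%N].
  apply: (inj_map val_inj).
  transitivity [seq i <- map val (enum 'I_n) | (n - m <= i)%N]; last by rewrite filter_map.
  rewrite map_drop val_enum_ord drop_iota add0n.
  set k := (n - m)%N; have kn : (k <= n)%N by exact: leq_subr.
  rewrite -[in RHS](subnKC kn) iotaD filter_cat.
  rewrite (_ : [seq i <- iota 0 k | (k <= i)%N] = [::]); last first.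
    rewrite -(filter_pred0 (iota 0 k)); apply: eq_in_filter => i.
    by rewrite mem_iota add0n /= => ik; rewrite leqNgt ik.
  rewrite add0n cat0s; apply/esym/all_filterP/allP => i.
  by rewrite mem_iota => /andP[].
by rewrite big_filter big_enum_cond.
Qed.

Lemma last_count_ge0 x m A : 0 <= last_count x m A.
Proof. by apply: sumr_ge0. Qed.

Lemma last_count_setT x m : (m <= n)%N -> last_count x m setT = m%:R.
Proof.
move=> mn; transitivity (#|remaining (n - m) (1%g : 'S_n)|%:R : R); last first.
  by rewrite card_remaining subKn.
rewrite -sum1_card natr_sum.
rewrite big_imset/=; last by move=> i j _ _; exact: perm_inj.
by apply: eq_big => [j|j _]; [rewrite inE|rewrite indicE in_setT].
Qed.

Lemma last_count_sub x m A B : A `<=` B -> last_count x m A <= last_count x m B.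
Proof.
move=> AB; apply: ler_sum => j _; rewrite !indicE.
by case: (boolP (x j \in A)) => // /set_mem Ax; rewrite mem_set//; exact: AB.
Qed.

Lemma last_count_mono x m m' A : (m <= m')%N -> last_count x m A <= last_count x m' A.
Proof.
move=> mm'; rewrite /last_count [leLHS]big_mkcond [leRHS]big_mkcond/=.
apply: ler_sum => j _; case: (boolP (n - m <= j)%N) => [h|_]; last by case: ifP.
by rewrite (leq_trans _ h)// leq_sub2l.
Qed.

Lemma last_countC x m A : (m <= n)%N ->
  last_count x m A + last_count x m (~` A) = m%:R.
Proof.
move=> mn; rewrite -(last_count_setT x mn) -big_split/=; apply: eq_bigr => j _.
rewrite !indicE in_setT in_setC; case: (_ \in A); by rewrite ?addr0 ?add0r.
Qed.

(* The complement of [A] bounds the increase of the count over [A]. *)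
Lemma last_count_lipschitz x m m' A : (m <= n)%N -> (m' <= n)%N ->
  `|last_count x m A - last_count x m' A| <= `|m%:R - m'%:R|.
Proof.
wlog mm' : m m' / (m <= m')%N.
  move=> H mn m'n; have [mm'|/ltnW m'm] := leqP m m'; first exact: H.
  by rewrite distrC [leRHS]distrC H.
move=> mn m'n; rewrite distrC [leRHS]distrC.
have mA := last_count_mono x A mm'; have mC := last_count_mono x (~` A) mm'.
rewrite ger0_norm ?subr_ge0// ger0_norm ?subr_ge0 ?ler_nat//.
have := last_countC x A mn; have := last_countC x A m'n; lra.
Qed.

Lemma last_countD x m A B : B `<=` A ->
  last_count x m (A `\` B) = last_count x m A - last_count x m B.
Proof.
move=> BA; rewrite /last_count -sumrB; apply: eq_bigr => j _.
rewrite !indicE in_setD.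
case: (boolP (x j \in B)) => [/set_mem/BA Ax|_]; rewrite ?andbT ?subr0//.
by rewrite mem_set// subrr.
Qed.

End counting.

(** * Almost sure control at a fixed level and a fixed set *)

Section almost_sure.
Context {R : realType} {d : measure_display} {Omega : measurableType d}.
Variables (P : probability Omega R) (F : probability R R).
Variables (Y : forall n, 'I_n -> {RV P >-> R}) (sigma : forall n, Omega -> 'S_n).
Hypothesis Ysigma : forall n, (0 < n)%N -> size_biased_choice (@Y n) (@sigma n).
Hypothesis indY : forall n, (0 < n)%N -> mutually_independent (@Y n).
Hypothesis YF : forall n, (0 < n)%N ->
  forall i (B : set R), measurable B -> distribution P (@Y n i) B = F B.
Hypothesis F_pos : F `]0, +oo[%classic = 1%E.

Lemma geometric_nneseries_lty (c q : R) : 0 <= c -> 0 <= q -> q < 1 ->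
  (\sum_(n <oo) (c * q ^+ n)%:E < +oo)%E.
Proof.
move=> c0 q0 q1.
apply: (@le_lt_trans _ _ (c / (1 - q))%:E); last exact: ltry.
apply: lime_le; first by apply: is_cvg_nneseries => n _ _; rewrite lee_fin mulr_ge0// exprn_ge0.
apply: nearW => n; rewrite sumEFin lee_fin -mulr_sumr ler_wpM2l//.
rewrite big_mkord; have q10 : 0 < 1 - q by rewrite subr_gt0.
rewrite -(ler_pM2l q10) divff ?gt_eqF// -opprB mulNr -subrX1 opprB.
by rewrite gerBl exprn_ge0.
Qed.

(** The probabilities of visiting no typical set are summable, being at most [4 * q ^+ n] with
    [q < 1]; Borel-Cantelli concludes. The witness [k] is the random rank at which the remaining set
    is typical. *)
Lemma ae_typical (t eps : R) (A : set R) :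
  0 <= t -> 0 < eps -> eps <= 1 -> measurable A ->
  {ae P, forall w, \forall n \near \oo, exists k, [/\ (k <= n)%N,
    `|(n - k)%:R - n%:R * survival F t setT| <= n%:R * eps &
    `|\sum_(i in remaining k (@sigma n w)) \1_A (@Y n i w) - n%:R * survival F t A|
       <= n%:R * eps]}.
Proof.
move=> t0 e0 e1 mA.
(* The sequences are controlled only for [0 < n]; the guard makes the event empty at [n = 0]. *)
pose av n w := (0 < n)%N && avoid (@Y n) (@sigma n) (@typical _ F n t eps A) 0 w.
pose E n := [set w | av n w].
pose q := expR (- (eps ^+ 2 / 8)).
have q1 : q < 1 by rewrite -expR0 ltr_expR oppr_lt0 divr_gt0// exprn_gt0.
have q0 : 0 <= q by exact: expR_ge0.
have avM n : measurable_fun setT (fun w => (av n w)%:R : R).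
  rewrite /av; case: (posnP n) => [_|n0] //=.
  apply: measurable_avoid; [exact: Ysigma|exact: measurable_typical].
have indE n : \1_(E n) = (fun w => (av n w)%:R : R).
  apply/funext => w; rewrite indicE; congr (nat_of_bool _)%:R.
  by apply/idP/idP => [|h]; rewrite inE.
have mE n : measurable (E n) by apply/(@measurable_indicP _ _ R); rewrite indE.
have PE n : (P (E n) <= (4 * q ^+ n)%:E)%E.
  rewrite -[E n]setIT -integral_indic// indE /av; have [n0|n0] := posnP n.
    by rewrite /= integral0 lee_fin mulr_ge0// exprn_ge0.
  rewrite /=; apply: le_trans (avoid_typical_le _ _ _ _ _ _ _ _) _ => //.
  - exact: Ysigma.
  - exact: indY.
  - exact: YF.
  - by rewrite lee_fin /q -expRM_natl mulrN [n%:R * (_ / _)]mulrA.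
have : P (lim_sup_set E) = 0%E.
  apply: lim_sup_set_cvg0 => //.
  apply: le_lt_trans (geometric_nneseries_lty (ler0n R 4) q0 q1).
  by apply: lee_nneseries => n *; [exact: measure_ge0|exact: PE].
move=> E0; exists (lim_sup_set E); split => //.
  by apply: bigcap_measurable => // m _; apply: bigcup_measurable => j _.
move=> w /= nw m _; apply: contrapT => nE; apply: nw.
exists (maxn 1 m) => // n /= mn.
have n0 : (0 < n)%N by rewrite (leq_trans _ mn)// leq_maxl.
have : ~~ av n w.
  apply/negP => h; apply: nE; exists n => //=; by rewrite (leq_trans _ mn)// leq_maxr.
rewrite /av n0 /= negb_forall => /existsP[k]; rewrite negbK => /andP[h1 h2].
exists k; split.
- by rewrite -ltnS.
- by rewrite card_remaining in h1.
- move: h2; under [\sum_(i in _) \1_A (tnth _ _)]eq_bigr do rewrite tnth_mktuple.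
  by [].
Qed.

(** The error has three sources: [n * eps] for the count at the random rank, [n * eps] for the
    distance of that rank from its target, which the Lipschitz property carries over to the count,
    and [1] for the integer part. *)
Lemma ae_last_count (t eps : R) (A : set R) :
  0 <= t -> 0 < eps -> eps <= 1 -> measurable A ->
  {ae P, forall w, \forall n \near \oo,
    `|last_count (fun i => @Y n (@sigma n w i) w)
        (Num.truncn (n%:R * survival F t setT)) A - n%:R * survival F t A|
      <= 1 + 2 * (n%:R * eps)}.
Proof.
move=> t0 e0 e1 mA; apply: filterS (ae_typical t0 e0 e1 mA) => w.
apply: filterS => n [k [kn h1 h2]].
set u := survival F t setT in h1 *; set x := fun i => _.
have u0 : 0 <= u by exact: survival_ge0.
have u1 : u <= 1 by exact: survival_le1.
have nu0 : 0 <= n%:R * u by rewrite mulr_ge0.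
have mn : (Num.truncn (n%:R * u) <= n)%N.
  by rewrite -(ler_nat R) (@le_trans _ _ (n%:R * u)) ?truncn_le// -[leRHS]mulr1 ler_wpM2l.
have := last_count_lipschitz x A mn (leq_subr k n).
have -> : last_count x (n - k) A = \sum_(i in remaining k (@sigma n w)) \1_A (@Y n i w).
  rewrite big_imset/=; last by move=> i j _ _; exact: perm_inj.
  by apply: eq_bigl => j; rewrite inE subKn.
set m := Num.truncn _; set c := last_count _ _ _; set c' := \sum_(i in _) _ => Lip.
have m1 : m%:R <= n%:R * u by rewrite truncn_le.
have m2 : n%:R * u < m%:R + 1 by rewrite natr1 truncnS_gt.
have : `|m%:R - (n - k)%:R| <= 1 + n%:R * eps.
  rewrite (le_trans (ler_distD (n%:R * u) _ _))// lerD//; last by rewrite distrC.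
  by rewrite ler_norml; apply/andP; split; lra.
have := ler_distD c' c (n%:R * survival F t A).
by move: Lip h2; rewrite -/c'; lra.
Qed.

End almost_sure.

(** * The tilted distributions *)

Section survival_theory.
Context {R : realType} (F : probability R R).
Implicit Types (t s : R) (A B : set R).

Let mc t A : measurable A -> measurable_fun setT (fun x => clock t x * \1_A x).
Proof. by move=> mA; apply: measurable_funM => //; exact: measurable_clock. Qed.

Let c0 t A x : 0 <= clock t x * \1_A x.
Proof. by rewrite mulr_ge0// clock_ge0. Qed.

Lemma survivalD t A B : 0 <= t -> measurable A -> measurable B -> B `<=` A ->
  survival F t (A `\` B) = survival F t A - survival F t B.
Proof.
move=> t0 mA mB BA; apply/eqP; rewrite -subr_eq opprK; apply/eqP/EFin_inj.
have mAB : measurable (A `\` B) by exact: measurableD.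
rewrite EFinD -!survivalE// -ge0_integralD//=; last 4 first.
- by move=> x _; rewrite lee_fin.
- by apply/measurable_EFinP; exact: mc.
- by move=> x _; rewrite lee_fin.
- by apply/measurable_EFinP; exact: mc.
apply: eq_integral => x _; rewrite -EFinD -mulrDr; congr (_ * _)%:E.
rewrite !indicE in_setD; case: (boolP (x \in B)) => [/set_mem/BA Ax|_].
  by rewrite andbF add0r mem_set.
by rewrite andbT addr0.
Qed.

Lemma clock_le s t x : s <= t -> clock t x <= clock s x.
Proof. by move=> st; rewrite ler_expR lerN2 ler_wpM2r// le_max lexx orbT. Qed.

(** The difference is the surviving mass of [B] outside [A], and the clock factor decreases with
    time. *)
Lemma survival_sub s t A B : 0 <= s -> s <= t -> measurable A -> measurable B ->
  A `<=` B ->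
  survival F t B - survival F t A <= survival F s B - survival F s A.
Proof.
move=> s0 st mA mB AB; have t0 := le_trans s0 st.
have mBA : measurable (B `\` A) by exact: measurableD.
rewrite -(survivalD t0 mB mA AB) -(survivalD s0 mB mA AB).
rewrite -lee_fin -(survivalE F t0 mBA) -(survivalE F s0 mBA).
apply: ge0_le_integral => //.
- by move=> x _; rewrite lee_fin.
- by apply/measurable_EFinP; exact: mc.
- by apply/measurable_EFinP; exact: mc.
- by move=> x _; rewrite lee_fin ler_wpM2r// clock_le.
Qed.

(** The analogue of [last_count_lipschitz]: the masses of [A] and of its complement both decrease in
    time, so neither loses more than the total. *)
Lemma survival_lipschitz s t A : 0 <= s -> 0 <= t -> measurable A ->
  `|survival F s A - survival F t A| <=
  `|survival F s setT - survival F t setT|.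
Proof.
wlog st : s t / s <= t.
  move=> H s0 t0 mA; have [st|/ltW ts] := leP s t; first exact: H.
  by rewrite distrC [leRHS]distrC; exact: H.
move=> s0 t0 mA.
have h1 := survival_sub s0 st measurable0 mA (@sub0set _ _).
have h2 := survival_sub s0 st mA measurableT (@subsetT _ _).
have S0 r : survival F r set0 = 0.
  rewrite /survival; under eq_Rintegral do rewrite indic0 mulr0.
  by rewrite /Rintegral integral0.
rewrite !S0 !subr0 in h1.
move: h1 h2; move: (survival F s A) (survival F t A) => a b.
move: (survival F s setT) (survival F t setT) => a' b' h1 h2.
by rewrite !ger0_norm; lra.
Qed.

Lemma survival0 A : measurable A -> (survival F 0 A)%:E = F A.
Proof.
move=> mA; rewrite -survivalE//.
transitivity (\int[F]_x (\1_A x)%:E)%E; last by rewrite integral_indic// setIT.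
apply: eq_integral => x _.
by rewrite /clock mul0r oppr0 expR0 mul1r.
Qed.

Lemma clock_continuous x : continuous (fun t => clock (Num.max t 0) x).
Proof.
rewrite /clock => t; apply: continuous_comp; last exact: continuous_expR.
apply: continuousN; apply: continuousM; last exact: cst_continuous.
apply: continuous_max; last exact: cst_continuous.
exact: cvg_id.
Qed.

(** The maximum with [0] extends the function to all real times with the domination by [1]
    preserved, so continuity under the integral holds on an open interval around any [t], including
    [0]. *)
Lemma survival_continuous : continuous (fun t => survival F (Num.max t 0) setT).
Proof.
move=> t.
pose f (l x : R) : R := clock (Num.max l 0) x * \1_setT x.
have : {in `]t - 1, t + 1[%classic, continuous (fun l => \int[F]_(x in setT) f l x)}.
  apply: (@continuity_under_integral _ _ _ F _ setT _ _ _ _ _ (cst 1)) => //.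
  - move=> l _; apply/integrableP; split.
      by apply/measurable_EFinP; exact: mc.
    rewrite (_ : (\int[F]_x _)%E = (survival F (Num.max l 0) setT)%:E) ?ltry//.
    rewrite -survivalE// ?le_max ?lexx ?orbT//; apply: eq_integral => x _.
    by rewrite gee0_abs// lee_fin; exact: c0.
  - apply: aeW => x _ l _.
    apply: (continuousM (s := fun l : R => clock (Num.max l 0) x)
      (t := cst (\1_setT x))); last exact: cst_continuous.
    exact: clock_continuous.
  - exact: finite_measure_integrable_cst.
  - move=> l _; apply: aeW => x _; rewrite ger0_norm ?c0// /f.
    by rewrite indicE in_setT mulr1 /cst clock_le1// le_max lexx orbT.
move=> /(_ t); apply; rewrite inE/= in_itv/=; apply/andP; split; lra.
Qed.

Hypothesis F_pos : F `]0, +oo[%classic = 1%E.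

Lemma ae_positive : {ae F, forall x, 0 < x}.
Proof.
exists `]-oo, 0]%classic; split => //.
  rewrite -setCitvr.
  by have /= -> := probability_setC F (measurable_itv `]0%R, +oo[); rewrite F_pos subee.
by move=> x /negP; rewrite -leNgt /= in_itv.
Qed.

Lemma survival_setT0 : survival F 0 setT = 1.
Proof. by apply/EFin_inj; rewrite survival0//; exact: probability_setT. Qed.

Lemma survival_cvg0 : survival F n%:R setT @[n --> \oo] --> 0.
Proof.
have [] := @dominated_convergence _ _ R F setT measurableT
  (fun n x => (clock n%:R x * \1_setT x)%:E) (cst 0%E) (cst 1%E).
- by move=> n; apply/measurable_EFinP; exact: mc.
- exact: measurable_cst.
- apply: filterS ae_positive => x x0 _.
  apply/fine_cvgP; split; first by apply: nearW.
  rewrite [X in X @ _ --> _](_ : _ = fun n => expR (- x) ^+ n).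
    apply: cvg_expr; rewrite ger0_norm ?expR_ge0//.
    by rewrite -expR0 ltr_expR oppr_lt0.
  apply/funext => n /=; rewrite indicE in_setT mulr1 /clock max_l ?ltW//.
  by rewrite -expRM_natl mulrN.
- exact: finite_measure_integrable_cst.
- apply: aeW => x n _; rewrite gee0_abs ?lee_fin//.
  by rewrite indicE in_setT mulr1 clock_le1.
move=> _ _; rewrite integral0 => /fine_cvgP[_].
by apply: cvg_trans; apply: near_eq_cvg; apply: nearW => n /=; rewrite survivalE.
Qed.

(** Intermediate values between the value [1] at time [0] and the limit [0] at infinity. *)
Lemma survival_surj u : 0 < u -> u <= 1 -> exists2 t, 0 <= t & survival F t setT = u.
Proof.
move=> u0 u1.
have : \forall n \near \oo, survival F n%:R setT < u.
  exact: (cvgr_lt 0 survival_cvg0).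
case=> N _ /(_ N (leqnn N)) /= Nu.
have [|c + cu] := @IVT R (fun t => survival F (Num.max t 0) setT) 0 N%:R u (ler0n _ _)
  (continuous_subspaceT survival_continuous).
  rewrite maxxx (max_l (ler0n R N)) survival_setT0.
  by rewrite ge_min le_max u1 (ltW Nu) orbT.
rewrite in_itv/= => /andP[c0' _].
by exists c => //; move: cu; rewrite (max_l c0').
Qed.

End survival_theory.

(** * Quantiles and finite bracketing of down-sets *)

Section quantiles.
Context {R : realType} (F : probability R R).

(** Here [survival F 0] is [F] with real values. The quantile is the supremum of the points where
    the distribution function is below [r]; the two bounds follow from continuity of the measure
    along increasing and decreasing half-lines. *)
Lemma quantile (r : R) : 0 < r -> r < 1 ->
  exists q, survival F 0 `]-oo, q[%classic <= r /\ r <= survival F 0 `]-oo, q]%classic.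
Proof.
move=> r0 r1.
pose G x := survival F 0 `]-oo, x]%classic.
have Gmono x y : x <= y -> G x <= G y.
  by move=> xy; apply: survival_le => // z /=; rewrite !in_itv/= => /le_trans; apply.
pose S := [set x | G x < r].
have cvgF (A : (set R)^nat) : (forall k, measurable (A k)) ->
    {homo A : m n / (m <= n)%N >-> m `<=` n} ->
    survival F 0 (A k) @[k --> \oo] --> survival F 0 (\bigcup_k A k).
  move=> mA ndA.
  have mU : measurable (\bigcup_k A k) by exact: bigcup_measurable.
  have h := @nondecreasing_cvg_mu _ _ R F A mA mU.
  have /h : nondecreasing_seq A by move=> m k mk; apply/subsetPset; exact: ndA.
  move=> {}h; have : (survival F 0 (A k))%:E @[k --> \oo] --> (survival F 0 (\bigcup_k A k))%:E.
    rewrite survival0// (_ : (fun k => _) = F \o A)//.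
    by apply/funext => k; exact: survival0.
  by move=> /fine_cvgP[].
have cvgF' (A : (set R)^nat) : (forall k, measurable (A k)) ->
    {homo A : m n / (m <= n)%N >-> n `<=` m} ->
    survival F 0 (A k) @[k --> \oo] --> survival F 0 (\bigcap_k A k).
  move=> mA ndA.
  have mU : measurable (\bigcap_k A k) by exact: bigcap_measurable.
  have FA0 : (F (A 0%N) < +oo)%E by rewrite -survival0// ltry.
  have h := @nonincreasing_cvg_mu _ _ R F A FA0 mA mU.
  have /h : nonincreasing_seq A by move=> m k mk; apply/subsetPset; exact: ndA.
  move=> {}h; have : (survival F 0 (A k))%:E @[k --> \oo] --> (survival F 0 (\bigcap_k A k))%:E.
    rewrite survival0// (_ : (fun k => _) = F \o A)//.
    by apply/funext => k; exact: survival0.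
  by move=> /fine_cvgP[].
have S0 : S !=set0.
  pose A (k : nat) := `]-oo, - k%:R]%classic : set R.
  have := @cvgF' A (fun k => measurable_itv _).
  have A0 : \bigcap_k A k = set0.
    rewrite -subset0 => x /(_ (Num.truncn (- x)).+1 I); rewrite /A /= in_itv/=.
    by rewrite lerNr leNgt truncnS_gt.
  rewrite A0 /survival; under eq_Rintegral do rewrite indic0 mulr0.
  rewrite /Rintegral integral0 => /(_ _)/cvgr_lt/(_ r r0)[|N _ /(_ N (leqnn N)) h].
    by move=> m k mk z; rewrite /A /= !in_itv/= => /le_trans; apply; rewrite lerN2 ler_nat.
  by exists (- N%:R).
have Sub : has_ubound S.
  pose A (k : nat) := `]-oo, k%:R]%classic : set R.
  have := @cvgF A (fun k => measurable_itv _).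
  have A0 : \bigcup_k A k = setT.
    rewrite -subTset => x _; exists (Num.truncn x).+1 => //; rewrite /A /= in_itv/=.
    by rewrite ltW// truncnS_gt.
  rewrite A0.
  have -> : survival F 0 setT = 1.
    by apply/EFin_inj; rewrite survival0//; exact: probability_setT.
  move=> /(_ _)/cvgr_gt/(_ r r1)[|N _ /(_ N (leqnn N)) h].
    by move=> m k mk z; rewrite /A /= !in_itv/= => /le_trans; apply; rewrite ler_nat.
  exists N%:R => x Sx; rewrite leNgt; apply/negP => /ltW /Gmono Nx.
  by have := lt_trans h (le_lt_trans Nx Sx); rewrite ltxx.
have hasS : has_sup S by [].
exists (sup S); split.
- have -> : `]-oo, sup S[%classic = \bigcup_k `]-oo, sup S - k.+1%:R^-1]%classic :> set R.
    apply/seteqP; split=> [x|x [k _]]; rewrite /= !in_itv/=.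
      move=> /ltr_add_invr[k xk]; exists k => //=; by rewrite in_itv/= lerBrDr ltW.
    by move=> /le_lt_trans; apply; rewrite ltrBlDr ltrDl.
  apply: (@ler_cvg_to _ _ _ _ _ _ _ _ (cvgF _ _ _) (cvg_cst r)) => //.
    move=> m k mk z; rewrite /= !in_itv/= => /le_trans; apply.
    by rewrite lerB// lef_pV2 ?posrE// ler_nat.
  apply: nearW => k.
  have k0 : 0 < k.+1%:R^-1 :> R by rewrite invr_gt0 ltr0n.
  have [y Sy ky] := sup_adherent k0 hasS.
  by apply: le_trans (ltW Sy); exact: Gmono (ltW ky).
- have -> : `]-oo, sup S]%classic = \bigcap_k `]-oo, sup S + k.+1%:R^-1]%classic :> set R.
    apply/seteqP; split=> [x|x h]; rewrite /= in_itv/=.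
      by move=> xS k _; rewrite /= in_itv/= (le_trans xS)// lerDl.
    rewrite leNgt; apply/negP => /ltr_add_invr[k kx].
    have := h k I; rewrite /= in_itv/= => xk.
    by have := lt_le_trans kx xk; rewrite ltxx.
  apply: (@ler_cvg_to _ _ _ _ _ _ _ _ (cvg_cst r) (cvgF' _ _ _)) => //.
    move=> m k mk z; rewrite /= !in_itv/= => /le_trans; apply.
    by rewrite lerD// lef_pV2 ?posrE// ler_nat.
  apply: nearW => k; rewrite leNgt; apply/negP => h.
  have := ub_le_sup Sub h; rewrite gerDl leNgt invr_gt0.
  by rewrite ltr0n.
Qed.

(** The brackets lie between consecutive quantiles of orders [j / K]. They are closed inside and
    open outside, so that an atom of [F] at a quantile does not count in the gap. *)
Lemma downset_sandwich (K : nat) : (0 < K)%N ->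
  exists C O : nat -> set R, [/\ forall j, measurable (C j),
    forall j, measurable (O j) &
    forall D : set R, (forall x y, D y -> x <= y -> D x) ->
      exists j, [/\ (j < K)%N, C j `<=` D, D `<=` O j &
        survival F 0 (O j) - survival F 0 (C j) <= K%:R^-1]].
Proof.
move=> K0; have K0' : 0 < K%:R :> R by rewrite ltr0n.
have Q j : exists q, (0 < j < K)%N ->
    survival F 0 `]-oo, q[%classic <= j%:R / K%:R /\
    j%:R / K%:R <= survival F 0 `]-oo, q]%classic.
  case: (boolP (0 < j < K)%N) => [/andP[j0 jK]|_]; last by exists 0.
  have [||q hq] := @quantile (j%:R / K%:R); last by exists q.
    by rewrite divr_gt0// ltr0n.
  by rewrite ltr_pdivrMr// mul1r ltr_nat.
have /choice[q hq] := Q.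
(* The quantiles exist only for [0 < j < K]; the empty set and the whole line stand for the orders
   [0] and [1]. *)
pose C j := if (0 < j)%N then `]-oo, q j]%classic else set0.
pose O j := if (j.+1 < K)%N then `]-oo, q j.+1[%classic else setT.
have mC j : measurable (C j) by rewrite /C; case: ifP.
have mO j : measurable (O j) by rewrite /O; case: ifP.
exists C, O; split => // D Dd.
have CO j : (j < K)%N -> survival F 0 (O j) - survival F 0 (C j) <= K%:R^-1.
  move=> jK.
  have h1 : survival F 0 (O j) <= j.+1%:R / K%:R.
    rewrite /O; case: ifPn => [h|]; first by have [] := hq j.+1 h.
    rewrite -leqNgt => Kj; have -> : K = j.+1 by apply/eqP; rewrite eqn_leq Kj jK.
    by rewrite divff ?pnatr_eq0// survival_le1.
  have h2 : j%:R / K%:R <= survival F 0 (C j).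
    rewrite /C; case: posnP => [->|j0]; first by rewrite mul0r survival_ge0.
    by have [|_] := hq j; rewrite ?j0.
  move: h1 h2; rewrite -natr1 mulrDl mul1r; lra.
(* A search through the quantiles: as long as they lie in [D], so does [C m]; the first one outside
   [D] bounds [D] from above. If none is outside, the last bracket, whose outer set is the whole
   line, works. *)
suff H m : (m < K)%N -> (exists j, [/\ (j < K)%N, C j `<=` D, D `<=` O j &
    survival F 0 (O j) - survival F 0 (C j) <= K%:R^-1]) \/ C m `<=` D.
  have [|//|CD] := H K.-1; first by rewrite prednK.
  exists K.-1; split => //; rewrite ?prednK//; last by apply: CO; rewrite prednK.
  by rewrite /O prednK// ltnn.
elim: m => [_|m IH mK]; first by right; rewrite /C ltnn.
have [||CD] := IH; [exact: ltnW|by left|].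
have [Dq|nDq] := pselect (D (q m.+1)).
  by right => x; rewrite /C /= in_itv/= => /(Dd _ _ Dq).
left; exists m; split => //; [exact: ltnW| |by apply: CO; exact: ltnW].
move=> x Dx; rewrite /O mK/= in_itv/= ltNge; apply/negP => qx; apply: nDq.
exact: Dd qx.
Qed.

End quantiles.

(** * Uniformity over intervals and levels *)

Section deterministic.
Context {R : realType} (F : probability R R) (n : nat) (x : 'I_n -> R).

Definition deviation (t : R) (A : set R) : R :=
  `|last_count x (Num.truncn (n%:R * survival F t setT)) A - n%:R * survival F t A|.

Variables (K : nat) (C O : nat -> set R) (tt : nat -> R).
Hypothesis K0 : (0 < K)%N.
Hypothesis mC : forall j, measurable (C j).
Hypothesis mO : forall j, measurable (O j).
Hypothesis sandwich : forall D : set R, (forall y z, D z -> y <= z -> D y) ->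
  exists j, [/\ (j < K)%N, C j `<=` D, D `<=` O j &
    survival F 0 (O j) - survival F 0 (C j) <= K%:R^-1].
Hypothesis tt0 : forall i, 0 <= tt i.
Hypothesis survival_tt : forall i, (0 < i <= K)%N -> survival F (tt i) setT = i%:R / K%:R.
Hypothesis dev_tt : forall i j, (0 < i <= K)%N -> (j < K)%N ->
  deviation (tt i) (C j) <= 1 + 2 * (n%:R / K%:R) /\
  deviation (tt i) (O j) <= 1 + 2 * (n%:R / K%:R).

(** With [e = n / K], the terms are [1 + 2 * e] for the deviation at a grid point, [e] for the
    bracket, [1 + e] for moving the number of last values to the grid level, and [e] for moving the
    survival mass to the grid time. *)
Lemma deviation_downset t (D : set R) : 0 <= t ->
  (forall y z, D z -> y <= z -> D y) ->
  deviation t D <= 2 + 5 * (n%:R / K%:R).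
Proof.
move=> t0 Dd.
have mD : measurable D.
  by apply: is_interval_measurable => a b Da Db z /andP[_ zb]; exact: Dd Db zb.
set u := survival F t setT.
have u0 : 0 <= u by exact: survival_ge0.
have u1 : u <= 1 by exact: survival_le1.
have K0' : 0 < K%:R :> R by rewrite ltr0n.
have [i iK iu] : exists2 i, (0 < i <= K)%N & `|u - i%:R / K%:R| <= K%:R^-1.
  have uK0 : 0 <= u * K%:R by rewrite mulr_ge0// ltW.
  have h1 : (Num.truncn (u * K%:R))%:R <= u * K%:R by rewrite truncn_le.
  have h2 := truncnS_gt (u * K%:R).
  (* Grid levels start at [1 / K]; a level [u < 1 / K] is still within [1 / K] of it. *)
  exists (maxn 1 (Num.truncn (u * K%:R))).
    rewrite leq_maxl /= geq_max K0 /= -(ler_nat R) (le_trans h1)//.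
    by rewrite ler_piMl// ltW.
  have -> : u - (maxn 1 (Num.truncn (u * K%:R)))%:R / K%:R =
      (u * K%:R - (maxn 1 (Num.truncn (u * K%:R)))%:R) / K%:R.
    by rewrite mulrBl mulfK// gt_eqF.
  have K00 : 0 <= K%:R^-1 :> R by rewrite invr_ge0.
  rewrite normrM (ger0_norm K00) -[leRHS]mul1r ler_wpM2r//.
  case: (posnP (Num.truncn (u * K%:R))) => [e|m0].
    by rewrite e in h2 *; rewrite (maxn_idPl _)// ler_norml; apply/andP; split; lra.
  rewrite -natr1 in h2; rewrite (maxn_idPr m0) ler_norml; apply/andP; split; lra.
have [j [jK CD DO CO]] := sandwich Dd.
have [] := dev_tt iK jK; rewrite /deviation survival_tt//.
set m' := Num.truncn (n%:R * (i%:R / K%:R)); set m := Num.truncn (n%:R * u).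
have nu0 : 0 <= n%:R * u by rewrite mulr_ge0.
have ni0 : 0 <= n%:R * (i%:R / K%:R) :> R by rewrite mulr_ge0// divr_ge0.
have i1 : i%:R / K%:R <= 1 :> R.
  by rewrite ler_pdivrMr// mul1r ler_nat; case/andP: iK.
have mn : (m <= n)%N.
  by rewrite -(ler_nat R) (@le_trans _ _ (n%:R * u)) ?truncn_le// ler_piMr.
have mn' : (m' <= n)%N.
  by rewrite -(ler_nat R) (@le_trans _ _ (n%:R * (i%:R / K%:R))) ?truncn_le// ler_piMr.
have Lm := last_count_lipschitz x D mn mn'.
have a1 : m%:R <= n%:R * u by rewrite /m truncn_le.
have a2 : n%:R * u < m%:R + 1 by rewrite natr1 truncnS_gt.
have b1 : m'%:R <= n%:R * (i%:R / K%:R) :> R by rewrite /m' truncn_le.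
have b2 : n%:R * (i%:R / K%:R) < m'%:R + 1 :> R by rewrite natr1 truncnS_gt.
have cC := last_count_sub x m' CD; have cO := last_count_sub x m' DO.
have sC := survival_le F (tt0 i) (mC j) mD CD.
have sO := survival_le F (tt0 i) mD (mO j) DO.
have sCO := survival_sub F (lexx 0) (tt0 i) (mC j) (mO j) (subset_trans CD DO).
have sL := survival_lipschitz F t0 (tt0 i) mD.
rewrite survival_tt// -/u in sL.
have n0 : 0 <= n%:R :> R by [].
have nle (a b : R) : a <= b -> n%:R * a <= n%:R * b by move=> ab; rewrite ler_wpM2l.
have {}sC := nle _ _ sC; have {}sO := nle _ _ sO.
have {sCO}CO := nle _ _ (le_trans sCO CO).
have nu : `|n%:R * u - n%:R * (i%:R / K%:R)| <= n%:R / K%:R.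
  by rewrite -mulrBr normrM ger0_norm// ler_wpM2l.
have nS : `|n%:R * survival F t D - n%:R * survival F (tt i) D| <= n%:R / K%:R.
  by rewrite -mulrBr normrM ger0_norm// ler_wpM2l// (le_trans sL).
rewrite mulrBr in CO.
move: Lm nu nS CO sC sO; set e := n%:R / K%:R.
set v := n%:R * (i%:R / K%:R).
have Lm' : `|m%:R - m'%:R| <= `|n%:R * u - v| + 1.
  have h1 := ler_norm (n%:R * u - v); have := ler_norm (v - n%:R * u).
  rewrite distrC => h2; rewrite -/v in b1 b2.
  by rewrite ler_norml; apply/andP; split; lra.
move=> Lm nu nS CO sC sO.
rewrite !ler_norml => /andP[c1 c2] /andP[b3 b4].
move: nS; rewrite ler_norml => /andP[s1 s2].
have := le_trans Lm Lm'; rewrite ler_norml => /andP[l1 l2].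
move: cC cO nu CO sC sO c1 c2 b3 b4 s1 s2 l1 l2; clear.
by move=> *; apply/andP; split; lra.
Qed.

(** An interval is the difference of two nested down-sets: the points below some point of [I], minus
    those strictly below all of [I]. This doubles the error. *)
Lemma deviation_interval t (I : set R) : 0 <= t -> is_interval I ->
  deviation t I <= 4 + 10 * (n%:R / K%:R).
Proof.
move=> t0 Ii.
pose D1 := [set y | exists2 z, I z & y <= z].
pose D2 := D1 `&` [set y | forall z, I z -> y < z].
have D1d y z : D1 z -> y <= z -> D1 y.
  by move=> [w Iw zw] yz; exists w => //; exact: le_trans zw.
have D2d y z : D2 z -> y <= z -> D2 y.
  move=> [h1 h2] yz; split; first exact: D1d h1 yz.
  by move=> w /h2; exact: le_lt_trans.
have IE : I = D1 `\` D2.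
  apply/seteqP; split=> [y Iy|y [[z Iz yz] nD2]].
    by split; [exists y|move=> [_ /(_ y Iy)]; rewrite ltxx].
  have [w Iw wy] : exists2 w, I w & w <= y.
    apply: contrapT => h; apply: nD2; split; first by exists z.
    by move=> w Iw; rewrite ltNge; apply/negP => wy; apply: h; exists w.
  by apply: (Ii w z) => //; rewrite wy.
have D21 : D2 `<=` D1 by move=> y [].
have mD (D : set R) : (forall y z, D z -> y <= z -> D y) -> measurable D.
  by move=> Dd; apply: is_interval_measurable => a b Da Db z /andP[_ zb]; exact: Dd Db zb.
have d1 := deviation_downset t0 D1d; have d2 := deviation_downset t0 D2d.
move: d1 d2; rewrite IE /deviation last_countD// survivalD//; [|exact: mD..].
rewrite mulrBr.
set a := last_count _ _ D1; set b := last_count _ _ D2.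
set a' := _ * survival F t D1; set b' := _ * survival F t D2.
rewrite !ler_norml => /andP[? ?] /andP[? ?]; apply/andP; split; lra.
Qed.

(** Normalizing by [n * u] instead of its integer part costs at most [1 / (n * u)], which turns
    [4 / n] into [5 / n]; then [u >= delta] is used. *)
Lemma empirical_deviation t (I : set R) (delta : R) : 0 <= t -> is_interval I ->
  (0 < n)%N -> 0 < delta -> delta <= survival F t setT ->
  `|empirical (last_values (Num.truncn (n%:R * survival F t setT)) x) I
    - survival F t I / survival F t setT| <= (5 / n%:R + 10 / K%:R) / delta.
Proof.
move=> t0 Ii n0 d0 du.
have := deviation_interval t0 Ii; rewrite /deviation /empirical sum_last_values.
set u := survival F t setT in du *; set m := Num.truncn _; set c := last_count _ _ _.
set S := survival F t I.
have u0 : 0 < u by exact: lt_le_trans du.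
have u1 : u <= 1 by exact: survival_le1.
have nr0 : 0 < n%:R :> R by rewrite ltr0n.
have nu0 : 0 < n%:R * u by rewrite mulr_gt0.
have mn : (m <= n)%N.
  by rewrite -(ler_nat R) (@le_trans _ _ (n%:R * u)) ?truncn_le ?(ltW nu0)// ler_piMr// ltW.
rewrite /last_values size_drop size_map size_enum_ord subKn// => dev.
have c0 : 0 <= c by exact: last_count_ge0.
have cm : c <= m%:R by rewrite -(last_count_setT x mn) last_count_sub.
have a1 : m%:R <= n%:R * u by rewrite /m truncn_le ltW.
have a2 : n%:R * u < m%:R + 1 by rewrite natr1 truncnS_gt.
have h1 : `|c / m%:R - c / (n%:R * u)| <= (n%:R * u)^-1.
  (* If [n * u < 1] there are no last values, and the empirical mass is [0] by the convention for
     division by [0]. *)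
  have [m0|m0] := posnP m.
    have -> : c = 0 by apply/eqP; rewrite eq_le c0 andbT (le_trans cm)// m0.
    by rewrite !mul0r subrr normr0 invr_ge0 ltW.
  have mr0 : 0 < m%:R :> R by rewrite ltr0n.
  have -> : c / m%:R - c / (n%:R * u) = (c / m%:R) * ((n%:R * u - m%:R) / (n%:R * u)).
    by field; rewrite !gt_eqF.
  rewrite ger0_norm; last first.
    by rewrite mulr_ge0// divr_ge0// ?subr_ge0// ltW.
  rewrite -[leRHS]mul1r ler_pM//.
  - by rewrite divr_ge0.
  - by rewrite divr_ge0 ?subr_ge0// ltW.
  - by rewrite ler_pdivrMr// mul1r.
  - have nui : 0 <= (n%:R * u)^-1 by rewrite invr_ge0 ltW.
    by rewrite -[leRHS]mul1r ler_wpM2r//; lra.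
have h2 : `|c / (n%:R * u) - S / u| <= (4 + 10 * (n%:R / K%:R)) / (n%:R * u).
  have -> : c / (n%:R * u) - S / u = (c - n%:R * S) / (n%:R * u).
    by field; rewrite !gt_eqF.
  have nui : 0 <= (n%:R * u)^-1 by rewrite invr_ge0 ltW.
  by rewrite normrM (ger0_norm nui) ler_wpM2r.
rewrite (le_trans (ler_distD (c / (n%:R * u)) _ _))// (le_trans (lerD h1 h2))//.
have K0' : 0 < K%:R :> R by rewrite ltr0n.
have -> : (n%:R * u)^-1 + (4 + 10 * (n%:R / K%:R)) / (n%:R * u) =
    (5 / n%:R + 10 / K%:R) / u.
  by field; rewrite !gt_eqF.
rewrite ler_wpM2l ?addr_ge0 ?divr_ge0//.
by rewrite lef_pV2.
Qed.

End deterministic.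

(** * Size-biased permutations *)

Lemma near_bounded (T : Type) (FF : set_system T) {FFF : Filter FF} (K : nat)
    (Q : nat -> T -> Prop) :
  (forall j, \forall z \near FF, Q j z) ->
  \forall z \near FF, forall j, (j < K)%N -> Q j z.
Proof.
move=> h; elim: K => [|K IH]; first by apply: nearW.
apply: filterS2 IH (h K) => z h1 h2 j; rewrite ltnS leq_eqVlt => /orP[/eqP ->//|].
exact: h1.
Qed.

Section bridge.
Context {R : realType} (F0 : probability (measurableTypeR R) R).
Hypothesis F_pos : F0 `]0, +oo[%classic = 1%E.

Let idTR : measurableTypeR R -> R := idfun.

#[local] HB.instance Definition _ :=
  @isMeasurableFun.Build _ _ _ _ idTR (@measurable_id _ _ setT).

(* [F0] transported to the measurable structure that random variables use on
   [R]: same measurable sets, different display. *)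
Definition law : probability R R := distribution F0 (idTR : {RV F0 >-> R}).

Lemma integral_law (f : R -> R) : measurable_fun setT f -> (forall x, 0 <= f x) ->
  (\int[law]_x (f x)%:E = \int[F0]_x (f x)%:E)%E.
Proof.
move=> mf f0; rewrite ge0_integral_distribution//; exact/measurable_EFinP.
Qed.

Lemma law_pos : law `]0, +oo[%classic = 1%E.
Proof. exact: F_pos. Qed.

Lemma integral_exp (t c : R) (A : set R) : 0 <= t -> 0 <= c -> measurable A ->
  A `<=` `]0, +oo[%classic ->
  \int[F0]_(x in A) (expR (- (t * x)) / c) = survival law t A / c.
Proof.
move=> t0 c0 mA A0.
rewrite -[RHS]/(fine (survival law t A / c)%:E); congr fine.
rewrite integral_mkcond.
transitivity (\int[law]_x ((c^-1)%R%:E * (clock t x * \1_A x)%:E))%E.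
  under [RHS]eq_integral do rewrite -EFinM.
  rewrite integral_law; last 2 first.
  - apply: measurable_funM => //; apply: measurable_funM => //; exact: measurable_clock.
  - by move=> x; rewrite mulr_ge0 ?invr_ge0// mulr_ge0// clock_ge0.
  apply: eq_integral => x _; rewrite /patch indicE; case: ifPn => [|_].
    rewrite inE => /A0; rewrite /= in_itv/= andbT => x0.
    by rewrite mulr1 mulrC /clock max_l// ltW.
  by rewrite !mulr0.
rewrite ge0_integralZl//; last 3 first.
- apply/measurable_EFinP; apply: measurable_funM => //; exact: measurable_clock.
- by move=> x _; rewrite lee_fin mulr_ge0// clock_ge0.
- by rewrite lee_fin invr_ge0.
by rewrite survivalE// -EFinM mulrC.
Qed.

(** At time [0] the nonpositive numbers carry no mass, and by [survival_sub] their surviving mass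
    cannot grow. *)
Lemma laplace_survival t : 0 <= t -> laplace F0 t = survival law t setT.
Proof.
move=> t0; transitivity (survival law t `]0, +oo[%classic).
  rewrite -[RHS]divr1 -integral_exp// /laplace; congr fine.
  by apply: eq_integral => x _; rewrite divr1.
apply/eqP; rewrite eq_le survival_le//=.
have := survival_sub law (lexx 0) t0 (measurable_itv `]0%R, +oo[) measurableT
  (@subsetT _ _).
have -> : survival law 0 `]0, +oo[%classic = 1.
  by apply/EFin_inj; rewrite survival0// law_pos.
by rewrite survival_setT0// subrr subr_le0.
Qed.

(** Surjectivity of the Laplace transform onto the levels in []0, 1]] makes ['pinv_] a right inverse
    there, with values in the nonnegative times. *)
Lemma laplace_invP u : 0 < u -> u <= 1 ->
  0 <= laplace_inv F0 u /\ survival law (laplace_inv F0 u) setT = u.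
Proof.
move=> u0 u1.
have surj : set_surj `[0, +oo[%classic [set v | 0 < v /\ v <= 1] (laplace F0).
  move=> v [v0 v1]; have [t t0 tv] := survival_surj law_pos v0 v1.
  by exists t; rewrite ?laplace_survival//= in_itv/= t0.
have inv0 : 0 <= laplace_inv F0 u.
  have := @surjpinv_image_sub _ _ (fun=> 0) _ _ _ surj (laplace_inv F0 u).
  rewrite /= in_itv/= andbT; apply; by exists u.
split=> //; rewrite -laplace_survival// /laplace_inv (surjpK (fun=> 0) surj)//.
by rewrite inE.
Qed.

Lemma tilted_survival u (A : set R) : 0 < u -> u <= 1 -> measurable A ->
  A `<=` `]0, +oo[%classic ->
  tilted F0 u A = survival law (laplace_inv F0 u) A / u.
Proof.
move=> u0 u1 mA A0; have [t0 _] := laplace_invP u0 u1.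
rewrite -(integral_exp t0 (ltW u0) mA A0).
by apply: eq_Rintegral => x _; rewrite [_ * x]mulrC.
Qed.

End bridge.

Theorem corollary21 (R : realType)
    (F : probability (measurableTypeR R) R)
    (F_pos : F `]0, +oo[%classic = 1%E)
    (d : measure_display) (Omega : measurableType d) (P : probability Omega R)
    (Y X : forall n : nat, 'I_n -> {RV P >-> R})
    (Y_iid : forall n, (0 < n)%N -> iid F (Y n))
    (X_sbp : forall n, (0 < n)%N -> size_biased_permutation (Y n) (X n))
    (delta : R) (delta_gt0 : 0 < delta) (delta_lt1 : delta < 1) :
  {ae P, forall w : Omega,
    ereal_sup
      [set ereal_sup
         [set `| empirical
                   (last_values (Num.truncn (n%:R * u)) (fun i => X n i w)) I
                 - tilted F u I |%:E
         | I in [set I : set R | is_interval I /\ I `<=` `]0, +oo[]]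
      | u in `[delta, 1]]
    @[n --> \oo] --> 0%E}.
Proof.
(* One permutation is chosen for every [n], with a dummy at [n = 0], where nothing is assumed. *)
have sigma_ex : forall n, exists s : Omega -> 'S_n, (0 < n)%N ->
    size_biased_choice (Y n) s /\ forall i w, X n i w = Y n (s w i) w.
  move=> n; have [n0|n0] := posnP n; first by exists (fun=> 1%g).
  by have [s s1 s2] := X_sbp n n0; exists s.
pose sigma n := projT1 (cid (sigma_ex n)).
have sigmaP n : (0 < n)%N -> size_biased_choice (Y n) (sigma n) /\
    forall i w, X n i w = Y n (sigma n w i) w := projT2 (cid (sigma_ex n)).
have YF n : (0 < n)%N -> forall i (B : set R), measurable B ->
    distribution P (Y n i) B = law F B.
  by move=> n0 i B mB; have [_ h] := Y_iid n n0; exact: h.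
have lpos := law_pos F_pos.
pose D n w u I : R := `| empirical (last_values (Num.truncn (n%:R * u)) (fun i => X n i w)) I
                 - tilted F u I |.
pose supD n w : \bar R := ereal_sup [set ereal_sup [set (D n w u I)%:E
    | I in [set I : set R | is_interval I /\ I `<=` `]0, +oo[%classic]]
  | u in `[delta, 1]%classic].
(* Countably many bounds tending to [0] suffice, since their exceptional null sets can be united. *)
suff bound (k : nat) : {ae P, forall w, \forall n \near \oo,
    forall u, delta <= u -> u <= 1 ->
    forall I, is_interval I -> I `<=` `]0, +oo[%classic ->
    D n w u I <= 15 / k.+1%:R / delta}.
  apply: filterS (ae_foralln bound) => w {}bound.
  apply/fine_cvgP.
  have sup_le n M : (forall u, delta <= u -> u <= 1 ->
      forall I, is_interval I -> I `<=` `]0, +oo[%classic -> D n w u I <= M) ->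
      (supD n w <= M%:E)%E.
    move=> h; apply: ge_ereal_sup => _ [u /= + <-]; rewrite in_itv/= => /andP[u1 u2].
    by apply: ge_ereal_sup => _ [I [/= I1 I2] <-]; rewrite lee_fin; exact: h.
  (* The level [1] and the empty interval show that the outer and inner suprema are not over empty
     families; with an upper bound, this makes the supremum finite. *)
  have sup_ge n : (0 <= supD n w)%E.
    apply: (@le_trans _ _ (D n w 1 set0)%:E); first by rewrite lee_fin /D normr_ge0.
    apply: (@le_trans _ _ (ereal_sup [set (D n w 1 I)%:E
         | I in [set I : set R | is_interval I /\ I `<=` `]0, +oo[%classic]])).
      by apply: ereal_sup_ubound; exists set0 => //; split => // a b [].
    by apply: ereal_sup_ubound; exists 1 => //=; rewrite in_itv/= lexx ltW.
  have fin n M : (forall u, delta <= u -> u <= 1 ->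
      forall I, is_interval I -> I `<=` `]0, +oo[%classic -> D n w u I <= M) ->
      supD n w \is a fin_num.
    by move=> h; rewrite ge0_fin_numE// (le_lt_trans (sup_le _ _ h))// ltry.
  split; first by apply: filterS (bound 0%N) => n; exact: fin.
  apply/cvgrPdist_le => e e0.
  have [k ke] : exists k : nat, 15 / k.+1%:R / delta <= e.
    exists (Num.truncn (15 / (e * delta))).
    have ed : 0 < e * delta by rewrite mulr_gt0.
    have := truncnS_gt (15 / (e * delta)).
    rewrite ltr_pdivrMr// => h.
    by rewrite ler_pdivrMr// ler_pdivrMr ?ltr0n// mulrC ltW.
  apply: filterS (bound k) => n h.
  rewrite sub0r normrN ger0_norm; last exact: (fine_ge0 (sup_ge n)).
  by rewrite (le_trans _ ke)// -lee_fin fineK ?(fin _ _ h)// sup_le.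
pose K := k.+1; have K0 : (0 < K)%N by [].
have [C [U [mC mU sandwich]]] := downset_sandwich (law F) K0.
have /choice[tt ttP] : forall i, exists t, 0 <= t /\
    ((0 < i <= K)%N -> survival (law F) t setT = i%:R / K%:R).
  move=> i; case: (boolP (0 < i <= K)%N) => [/andP[i0 iK]|_]; last by exists 0.
  have [||t t0 tE] := @survival_surj _ _ lpos (i%:R / K%:R); last by exists t.
    by rewrite divr_gt0// ltr0n.
  by rewrite ler_pdivrMr ?ltr0n// mul1r ler_nat.
have tt0 i : 0 <= tt i by have [] := ttP i.
have survival_tt i : (0 < i <= K)%N -> survival (law F) (tt i) setT = i%:R / K%:R.
  by have [_] := ttP i.
pose x n w := fun i => Y n (sigma n w i) w.
have aedev A i : measurable A -> {ae P, forall w, \forall n \near \oo,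
    deviation (law F) (x n w) (tt i) A <= 1 + 2 * (n%:R / K%:R)}.
  move=> mA.
  have e0 : 0 < K%:R^-1 :> R by rewrite invr_gt0 ltr0n.
  have e1 : K%:R^-1 <= 1 :> R by rewrite invf_le1 ?ltr0n// ler1n.
  apply: (ae_last_count (sigma := sigma) _ _ YF lpos (tt0 i) e0 e1 mA).
  - by move=> n n0; have [] := sigmaP n n0.
  - by move=> n n0; have [] := Y_iid n n0.
have : {ae P, forall w, forall i j, \forall n \near \oo,
    deviation (law F) (x n w) (tt i) (C j) <= 1 + 2 * (n%:R / K%:R) /\
    deviation (law F) (x n w) (tt i) (U j) <= 1 + 2 * (n%:R / K%:R)}.
  apply: ae_foralln => i; apply: ae_foralln => j.
  by apply: filterS2 (aedev _ i (mC j)) (aedev _ i (mU j)) => w; exact: filterS2.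
apply: filterS => w dev.
have : \forall n \near \oo, forall i, (i < K.+1)%N -> forall j, (j < K)%N ->
    deviation (law F) (x n w) (tt i) (C j) <= 1 + 2 * (n%:R / K%:R) /\
    deviation (law F) (x n w) (tt i) (U j) <= 1 + 2 * (n%:R / K%:R).
  by apply: near_bounded => i; apply: near_bounded => j; exact: dev.
(* For [K <= n], the bound [5 / n + 10 / K] is at most [15 / K], whence the constant [15]. *)
have : \forall n \near \oo, (K <= n)%N by exact: nbhs_infty_ge.
apply: filterS2 => n Kn devn u du u1 I Ii I0.
have u0 : 0 < u by exact: lt_le_trans du.
have n0 : (0 < n)%N by exact: leq_trans Kn.
have [t0 tu] := laplace_invP F_pos u0 u1.
have mI : measurable I by exact: is_interval_measurable.
have devn' i j : (0 < i <= K)%N -> (j < K)%N ->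
    deviation (law F) (x n w) (tt i) (C j) <= 1 + 2 * (n%:R / K%:R) /\
    deviation (law F) (x n w) (tt i) (U j) <= 1 + 2 * (n%:R / K%:R).
  by move=> /andP[_ iK] jK; exact: devn.
have := empirical_deviation K0 mC mU sandwich tt0 survival_tt devn' t0 Ii n0 delta_gt0.
rewrite tu => /(_ du); rewrite /D tilted_survival//.
have -> : (fun i => X n i w) = x n w.
  by apply/funext => i; have [_ ->] := sigmaP n n0.
move=> /le_trans; apply; rewrite ler_wpM2r ?invr_ge0 ?(ltW delta_gt0)//.
have : n%:R^-1 <= K%:R^-1 :> R by rewrite lef_pV2 ?posrE ?ltr0n// ler_nat.
rewrite -/K; lra.
Qed.
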